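(* Let $0<a\le b\le2$, let $\alpha:\mathbf{R}\to[a,b]$ be continuous, let $0<H<1$, $\lambda>0$, and let $X_{H,\alpha(x),\lambda}$ be the linear tempered fractional multistable motion. For each $t\in\mathbf{R}$ satisfying $H\alpha(t)\ne1$ and all $\gamma\in(0,a)$, $$\lim_{r\to0+}\frac{\mathbf{E}\big[|X_{H,\alpha(x),\lambda}(t+r)-X_{H,\alpha(x),\lambda}(t)|^\gamma\big]}{r^{\gamma H}}=F(\gamma,t),$$ where $$F(\gamma,t)=\bigg(\int_{-\infty}^\infty\Big|(1-x)_+^{H-\frac1{\alpha(t)}}-(-x)_+^{H-\frac1{\alpha(t)}}\Big|^{\alpha(t)}dx\bigg)^{\gamma/\alpha(t)}\ \frac{2^{\gamma-1}\,\Gamma\big(1-\frac{\gamma}{\alpha(t)}\big)}{\gamma\int_0^\infty u^{-\gamma-1}\sin^2(u)\,du}$$ and $\Gamma(s)=\int_0^\infty x^{s-1}e^{-x}dx$ is the gamma function.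
   Context: Conventions: $(x)_+=\max\{x,0\}$ and $0^\gamma=0$ for all $\gamma\in\mathbf{R}$. Set $$G_{H,\alpha(x),\lambda}(t,x)=e^{-\lambda(t-x)_+}(t-x)_+^{H-\frac1{\alpha(x)}}-e^{-\lambda(-x)_+}(-x)_+^{H-\frac1{\alpha(x)}} .$$ The multistable stochastic integral $I(f)=\int f(x)\,dM_\alpha(x)$, defined for measurable $f$ with $\int_{-\infty}^\infty|f(x)|^{\alpha(x)}dx<\infty$, is specified by its finite-dimensional distributions: $\mathbf{E}[e^{i\sum_{k=1}^d\theta_kI(f_k)}]=\exp\{-\int_{-\infty}^\infty|\sum_{k=1}^d\theta_kf_k(x)|^{\alpha(x)}dx\}$. The linear tempered fractional multistable motion (LTFmSM) is $X_{H,\alpha(x),\lambda}(t)=\int_{-\infty}^\infty G_{H,\alpha(x),\lambda}(t,x)\,dM_\alpha(x)$, $t\in\mathbf{R}$; thus $$\mathbf{E}\Big[e^{i\sum_{k=1}^d\theta_kX_{H,\alpha(x),\lambda}(t_k)}\Big]=\exp\Big\{-\int_{-\infty}^\infty\Big|\sum_{k=1}^d\theta_kG_{H,\alpha(x),\lambda}(t_k,x)\Big|^{\alpha(x)}dx\Big\}.$$ *)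

(* Defs.v *)
From HB Require Import structures.
From mathcomp Require Import all_boot all_order all_algebra.
From mathcomp Require Import all_classical all_reals all_analysis.
From mathcomp.real_closed Require complex.

Set Implicit Arguments.
Unset Strict Implicit.
Unset Printing Implicit Defensive.

Import Order.TTheory GRing.Theory Num.Theory.
Import numFieldNormedType.Exports.

Local Open Scope classical_set_scope.
Local Open Scope ring_scope.

(* Only used through qualified names: the notations of [complex] ('Re, 'i, ...)
   overlap with those of numClosedFieldType. *)
Notation Cplx := complex.complex.

Definition pospart (R : realType) (x : R) : R := Num.max x 0.

(* Power with the convention 0 ^ c = 0 for every c, including c = 0 and c < 0;
   the library has 0 `^ 0 = 1. *)
Definition pow0 (R : realType) (x c : R) : R := if x == 0 then 0 else x `^ c.

Definition ltfm_kernel (R : realType) (H : R) (alpha : R -> R) (lambda : R)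
    (t x : R) : R :=
  expR (- lambda * pospart (t - x)) * pow0 (pospart (t - x)) (H - (alpha x)^-1)
  - expR (- lambda * pospart (- x)) * pow0 (pospart (- x)) (H - (alpha x)^-1).

Definition multistable_integrable (R : realType) (alpha f : R -> R) : Prop :=
  measurable_fun [set: R] f /\
  (\int[lebesgue_measure]_x (`|f x| `^ alpha x)%:E < +oo)%E.

Definition expi (R : realType) (x : R) : Cplx R := complex.Complex (cos x) (sin x).

(* For Z with integrable real and imaginary parts, as is the case for
   unimodular Z. *)
Definition cexpectation (d : measure_display) (T : measurableType d)
    (R : realType) (P : probability T R) (Z : T -> Cplx R) : Cplx R :=
  complex.Complex (fine ('E_P[fun w => complex.Re (Z w)])%E)
                  (fine ('E_P[fun w => complex.Im (Z w)])%E).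

(* [I f] is a version of the integral of f against the multistable measure
   M_alpha; [I f] is unconstrained when f is not integrable. *)
Definition multistable_integral (d : measure_display) (T : measurableType d)
    (R : realType) (P : probability T R) (alpha : R -> R)
    (I : (R -> R) -> {RV P >-> R}) : Prop :=
  forall (n : nat) (theta : 'I_n -> R) (f : 'I_n -> R -> R),
    (forall k, multistable_integrable alpha (f k)) ->
    cexpectation P (fun w => expi (\sum_(k < n) theta k * I (f k) w)) =
    complex.Complex
      (expR (- \int[lebesgue_measure]_x
                 (`|\sum_(k < n) theta k * f k x| `^ alpha x)))
      0.

Definition LTFmSM (d : measure_display) (T : measurableType d)
    (R : realType) (P : probability T R) (H : R) (alpha : R -> R) (lambda : R)
    (X : R -> {RV P >-> R}) : Prop :=
  exists2 I : (R -> R) -> {RV P >-> R},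
    multistable_integral alpha I &
    forall t, {ae P, forall w, X t w = I (ltfm_kernel H alpha lambda t) w}.

Definition Gamma (R : realType) (s : R) : R :=
  \int[lebesgue_measure]_(x in `]0%R, +oo[) (x `^ (s - 1) * expR (- x)).

Definition Flim (R : realType) (H : R) (alpha : R -> R) (gamma t : R) : R :=
  (\int[lebesgue_measure]_x
     (`|pow0 (pospart (1 - x)) (H - (alpha t)^-1)
        - pow0 (pospart (- x)) (H - (alpha t)^-1)| `^ alpha t))
    `^ (gamma / alpha t)
  * (2 `^ (gamma - 1) * Gamma (1 - gamma / alpha t)
     / (gamma * \int[lebesgue_measure]_(u in `]0%R, +oo[)
                  (u `^ (- gamma - 1) * sin u ^+ 2))).

(* Main.v *)
Require Import Defs.
From HB Require Import structures.
From mathcomp Require Import all_boot all_order all_algebra.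
From mathcomp Require Import all_classical all_reals all_analysis.
From mathcomp Require Import measurable_realfun.
From mathcomp Require Import ring lra.

(** Write X(t+r) - X(t) = r^H Y_r.  The substitution x = t + r y in the kernel
    shows that the characteristic function of Y_r is exp(-J_r(theta)), where
    J_r(theta) is the integral over y of |theta g_r(y)|^{alpha(t + r y)} and
    g_r is an increment of the power function tempered at rate lambda r.
    A majorant of |g_r|^{alpha(t + r y)}, integrable and independent of r, gives
    J_r(theta) -> |theta|^{alpha(t)} K by dominated convergence, K being the
    integral in F(gamma, t), as well as J_r(theta) = O(|theta|^a) near 0.
    Integrating the identity |y|^gamma int_0^oo u^{-gamma-1} sin^2 u du =
    int_0^oo u^{-gamma-1} sin^2 (u y) du at y = Y_r expresses E|Y_r|^gamma as an
    integral of u^{-gamma-1} (1 - exp(-J_r(2u))) / 2.  The bound near 0 allows a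
    second dominated convergence, and the limiting integral is a gamma function. *)

Set Implicit Arguments.
Unset Strict Implicit.
Unset Printing Implicit Defensive.

Import Order.TTheory GRing.Theory Num.Theory.
Import numFieldNormedType.Exports.

Local Open Scope classical_set_scope.
Local Open Scope ring_scope.

(** * Affine changes of variables and reflection for nonnegative Lebesgue integrals *)

Section change_of_variables.
Context {R : realType}.
Notation mu := (@lebesgue_measure R).
Implicit Types f : R -> \bar R.
Local Open Scope ereal_scope.

Let affine (s t : R) (y : measurableTypeR R) : measurableTypeR R := (t + s * y)%R.

Let measurable_affine s t : measurable_fun setT (affine s t).
Proof. by apply: measurable_funD => //; exact: measurable_funM. Qed.

(** By uniqueness of Lebesgue measure it is enough to compare on half-open intervals: the preimage
    of such an interval is shorter by the factor [s], which the scaling restores. *)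
Let mu_affine (s t : R) : (0 < s)%R -> forall A : set (measurableTypeR R), measurable A ->
  mu A = s%:E * pushforward mu (affine s t) A.
Proof.
move=> s0.
pose nu := mscale (NngNum (ltW s0)) (pushforward mu (affine s t)).
move=> A mA; rewrite -[RHS]/(nu (@measurable_affine s t) A).
apply: lebesgue_measure_unique => // _ [[a b]] _ <-.
rewrite /nu /mscale /pushforward /=.
have /= preE : affine s t @^-1` `]a, b]%classic = `]((a - t) / s)%R, ((b - t) / s)%R]%classic.
  rewrite /affine; apply/seteqP; split => x /=; rewrite !in_itv/=;
  by rewrite ltr_pdivrMr// ler_pdivlMr// ltrBlDl lerBrDl (mulrC x).
rewrite [X in _ = _ * mu X]preE !lebesgue_measure_itv/= !lte_fin ltr_pM2r ?invr_gt0// ltrD2r.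
case: ifPn => _; last by rewrite mule0.
by rewrite -!EFinB -EFinM; congr EFin; field; rewrite gt_eqF.
Qed.

Lemma ge0_integral_affine f (s t : R) : (0 < s)%R ->
  measurable_fun [set: R] f -> (forall x, 0 <= f x) ->
  \int[mu]_x f x = s%:E * \int[mu]_x f (t + s * x)%R.
Proof.
move=> s0 mf f0.
have -> : \int[mu]_x f (t + s * x)%R = \int[pushforward mu (affine s t)]_y f y.
  by rewrite ge0_integral_pushforward.
rewrite -(ge0_integral_mscale _ _ (NngNum (ltW s0)))//.
by apply: eq_measure_integral => A mA _; exact: mu_affine.
Qed.

Lemma ge0_integral_affine_in f (s t : R) : (0 < s)%R ->
  measurable_fun [set: R] f -> (forall x, 0 <= f x) ->
  \int[mu]_x f x = \int[mu]_x (s%:E * f (t + s * x)%R).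
Proof.
move=> s0 mf f0; rewrite (ge0_integral_affine t s0 mf f0) ge0_integralZl//.
- exact: (measurableT_comp mf (@measurable_affine s t)).
- by rewrite lee_fin ltW.
Qed.

Lemma ge0_integral_oppr f : measurable_fun [set: R] f -> (forall x, 0 <= f x) ->
  \int[mu]_x f x = \int[mu]_x f (- x)%R.
Proof.
move=> mf f0.
have -> : \int[mu]_x f (- x)%R =
    \int[pushforward mu (-%R : _ -> measurableTypeR R)]_y f y.
  by rewrite ge0_integral_pushforward.
by apply: eq_measure_integral => A mA _; exact/esym/lebesgue_measureN.
Qed.

End change_of_variables.

(** * Integrability of power functions *)

Section power_integrals.
Context {R : realType}.
Notation mu := (@lebesgue_measure R).
Implicit Types p q c z : R.

Lemma measurable_powR_EFin (D : set R) p :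
  measurable_fun D (fun z : R => (z `^ p)%:E).
Proof.
apply/measurable_EFinP; exact: (measurable_funS measurableT).
Qed.

Lemma continuous_powR p z : 0 < z -> {for z, continuous (fun x : R => x `^ p)}.
Proof.
move=> z0; apply/differentiable_continuous/derivable1_diffP.
by apply: derivable_powR; rewrite in_itv/= z0.
Qed.

Lemma le0_ler_powR p x z : p <= 0 -> 0 < x -> x <= z -> z `^ p <= x `^ p.
Proof.
move=> p0 x0 xz; rewrite -(opprK p) !(powRN _ (- p)).
have z0 := lt_le_trans x0 xz.
by rewrite lef_pV2 ?posrE ?powR_gt0// ge0_ler_powR// ?nnegrE ?oppr_ge0 ?(ltW x0) ?(ltW z0).
Qed.

Let is_derive_powR_antiderivative p z : p + 1 != 0 -> 0 < z ->
  is_derive z 1 (fun x : R => (p + 1)^-1 * x `^ (p + 1)) (z `^ p).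
Proof.
move=> p1 z0.
have := is_deriveZ (p + 1)^-1 (is_derive1_powR (p + 1) z0).
by rewrite addrK /GRing.scale/= mulrA mulVf// mul1r.
Qed.

Let continuous_antiderivative p z : p + 1 != 0 -> 0 < z ->
  {for z, continuous (fun x : R => (p + 1)^-1 * x `^ (p + 1))}.
Proof. by move=> p1 z0; apply: cvgM; [exact: cvg_cst|exact: continuous_powR]. Qed.

Lemma powR_cvg_pinfty0 p : p < 0 -> (x : R) `^ p @[x --> +oo] --> (0 : R).
Proof.
move=> p0; apply/cvgrPdist_le => e e0.
near=> x.
have x0 : 0 < x by near: x; exact: nbhs_pinfty_gt.
rewrite sub0r normrN ger0_norm ?powR_ge0//.
have -> : e = (e `^ p^-1) `^ p by rewrite -powRrM mulVf ?lt_eqF// powRr1// ltW.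
have e'0 : 0 < e `^ p^-1 by exact: powR_gt0.
have xe : e `^ p^-1 <= x by near: x; exact: nbhs_pinfty_ge.
exact: le0_ler_powR (ltW p0) e'0 xe.
Unshelve. all: by end_near. Qed.

Lemma integral_powR_cy p c : p < -1 -> 0 < c ->
  (\int[mu]_(z in `[c, +oo[) (z `^ p)%:E = (c `^ (p + 1) / - (p + 1))%:E)%E.
Proof.
move=> p1 c0.
have p10 : p + 1 != 0 by rewrite lt_eqF//; lra.
have gtc z : c < z -> 0 < z by exact: lt_trans.
rewrite (@ge0_continuous_FTC2y _ _ (fun x : R => (p + 1)^-1 * x `^ (p + 1)) c 0).
- by rewrite sub0e -EFinN invrN mulrN mulrC.
- by move=> x _; exact: powR_ge0.
- apply/continuous_within_itvcyP; split.
    by move=> x; rewrite in_itv/= andbT => /gtc; exact: continuous_powR.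
  by apply: cvg_at_right_filter; exact: continuous_powR.
- rewrite -[X in _ --> X](mulr0 (p + 1)^-1).
  by apply: cvgM; [exact: cvg_cst|apply: powR_cvg_pinfty0; lra].
- by move=> x /gtc x0; have [] := is_derive_powR_antiderivative p10 x0.
- by apply: cvg_at_right_filter; exact: continuous_antiderivative.
- move=> x; rewrite in_itv/= andbT => /gtc x0.
  by rewrite derive1E; have [_ ->] := is_derive_powR_antiderivative p10 x0.
Qed.

(** The antiderivative gives (1 - c^(p+1)) / (p+1). The bound is free of [c], so that [c] can be
    sent to 0 even when [p] is negative. *)
Lemma integral_powR_cc p c : -1 < p -> 0 < c < 1 ->
  (\int[mu]_(z in `[c, 1%R]) (z `^ p)%:E <= ((p + 1)^-1)%:E)%E.
Proof.
move=> p1 /andP[c0 c1].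
have p10 : p + 1 != 0 by rewrite gt_eqF//; lra.
have gtc z : c < z -> 0 < z by exact: lt_trans.
rewrite (@continuous_FTC2 _ _ (fun x : R => (p + 1)^-1 * x `^ (p + 1)))//.
- rewrite powR1 mulr1 -EFinB lee_fin gerBl.
  by rewrite mulr_ge0 ?powR_ge0// invr_ge0; lra.
- apply/(continuous_within_itvP _ c1); split.
  + by move=> x; rewrite in_itv/= => /andP[/gtc + _]; exact: continuous_powR.
  + by apply: cvg_at_right_filter; exact: continuous_powR.
  + by apply: cvg_at_left_filter; exact: continuous_powR.
- split.
  + move=> x; rewrite in_itv/= => /andP[/gtc x0 _].
    by have [] := is_derive_powR_antiderivative p10 x0.
  + by apply: cvg_at_right_filter; exact: continuous_antiderivative.
  + by apply: cvg_at_left_filter; exact: continuous_antiderivative.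
- move=> x; rewrite in_itv/= => /andP[/gtc x0 _].
  by rewrite derive1E; have [_ ->] := is_derive_powR_antiderivative p10 x0.
Qed.

Lemma integral_powR_oc_lty p : -1 < p ->
  (\int[mu]_(z in `]0%R, 1%R]) (z `^ p)%:E < +oo)%E.
Proof.
move=> p1.
(* Monotone exhaustion of the interval, which keeps away from the possible singularity at 0. The
   index [i.+2] makes every left endpoint strictly smaller than 1. *)
pose F (i : nat) : set R := `[i.+2%:R^-1, 1%R]%classic.
have UF : \bigcup_i F i = `]0%R, 1%R]%classic.
  apply/seteqP; split => [x [i _]|x]; rewrite /F/= !in_itv/=.
    by move=> /andP[ix ->]; rewrite andbT (lt_le_trans _ ix)// invr_gt0.
  move=> /andP[x0 x1]; have [n nx] := @ltr_add_invr _ 0 x x0.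
  exists n => //=; rewrite in_itv/= x1 andbT.
  rewrite add0r in nx; apply: le_trans (ltW nx).
  by rewrite lef_pV2 ?posrE// ler_nat.
rewrite -UF.
have mF i : measurable (F i) by exact: measurable_itv.
have mf i : measurable_fun (F i) (fun z : R => (z `^ p)%:E).
  exact: measurable_powR_EFin.
have f0 i x : F i x -> (0 <= (x `^ p)%:E)%E.
  by move=> _; rewrite lee_fin powR_ge0.
have ndF : {homo F : n m / (n <= m)%N >-> (n <= m)%O}.
  move=> n m nm; apply/subsetPset => x; rewrite /F/= !in_itv/= => /andP[nx ->].
  by rewrite andbT (le_trans _ nx)// lef_pV2 ?posrE// ler_nat.
apply: (@le_lt_trans _ _ ((p + 1)^-1)%:E); last by rewrite ltry.
have /cvg_lim <- // := ge0_nondecreasing_set_cvg_integral (mu := mu) ndF mF mf f0.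
apply: lime_le.
  apply: ereal_nondecreasing_is_cvgn.
  exact: (ge0_nondecreasing_set_nondecreasing_integral mu ndF mF mf f0).
apply: nearW => i; apply: integral_powR_cc => //.
by rewrite invr_gt0 ltr0n/= invf_lt1// ltr1n.
Qed.

(** Model majorant on the half line: [p] governs the singularity at 0 and [q] the tail, so it is
    integrable as soon as -1 < p and q < -1. Every domination below reduces to it. *)
Definition piecewise_pow p q z : R :=
  if z <= 0 then 0 else if z <= 1 then z `^ p else z `^ q.

Lemma piecewise_pow_ge0 p q z : 0 <= piecewise_pow p q z.
Proof. by rewrite /piecewise_pow; do 2 case: ifP => _ //; exact: powR_ge0. Qed.

Lemma piecewise_pow_le0 p q z : z <= 0 -> piecewise_pow p q z = 0.
Proof. by rewrite /piecewise_pow => ->. Qed.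

Lemma piecewise_pow_le1 p q z : 0 < z -> z <= 1 -> piecewise_pow p q z = z `^ p.
Proof. by move=> z0 z1; rewrite /piecewise_pow z1 leNgt z0. Qed.

Lemma piecewise_pow_gt1 p q z : 1 < z -> piecewise_pow p q z = z `^ q.
Proof.
by move=> z1; rewrite /piecewise_pow leNgt (lt_trans ltr01 z1)/= leNgt z1.
Qed.

Lemma measurable_piecewise_pow p q : measurable_fun [set: R] (piecewise_pow p q).
Proof.
apply: measurable_fun_ifT => //; first exact: measurable_fun_ler.
apply: measurable_fun_ifT => //; first exact: measurable_fun_ler.
Qed.

Lemma integral_piecewise_pow_lty p q : -1 < p -> q < -1 ->
  (\int[mu]_z (piecewise_pow p q z)%:E < +oo)%E.
Proof.
move=> p1 q1.
pose f := ((fun z : R => (z `^ p)%:E) \_ `]0%R, 1%R])%E.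
pose g := ((fun z : R => (z `^ q)%:E) \_ `[1%R, +oo[)%E.
have mf : measurable_fun [set: R] f.
  by apply/(measurable_restrictT _ _).1 => //; exact: measurable_powR_EFin.
have mg : measurable_fun [set: R] g.
  by apply/(measurable_restrictT _ _).1 => //; exact: measurable_powR_EFin.
have f0 x : (0 <= f x)%E by apply: erestrict_ge0 => y _; rewrite lee_fin powR_ge0.
have g0 x : (0 <= g x)%E by apply: erestrict_ge0 => y _; rewrite lee_fin powR_ge0.
apply: (@le_lt_trans _ _ (\int[mu]_x (f x + g x)))%E.
  apply: ge0_le_integral => //.
  - by move=> x _; rewrite lee_fin piecewise_pow_ge0.
  - by apply/measurable_EFinP; exact: measurable_piecewise_pow.
  - exact: emeasurable_funD.
  - move=> x _; have [x0|x0] := leP x 0; first by rewrite piecewise_pow_le0// adde_ge0.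
    have [x1|x1] := leP x 1.
      rewrite piecewise_pow_le1// (_ : f x = (x `^ p)%:E) ?leeDl//.
      by rewrite /f patchE mem_set//= in_itv/= x0.
    rewrite piecewise_pow_gt1// (_ : g x = (x `^ q)%:E) ?leeDr//.
    by rewrite /g patchE mem_set//= in_itv/= ltW.
rewrite ge0_integralD// lte_add_pinfty//.
  by rewrite -integral_mkcond integral_powR_oc_lty.
by rewrite -integral_mkcond integral_powR_cy// ltry.
Qed.

End power_integrals.

(** * Increments of the tempered power *)

Section tempered_power.
Context {R : realType}.
Implicit Types (l c z y A H r K : R).

Lemma measurable_fun_powR d (T : measurableType d) (f g : T -> R) :
  measurable_fun setT f -> measurable_fun setT g ->
  measurable_fun setT (fun x => f x `^ g x).
Proof.
move=> mf mg; rewrite /powR.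
apply: measurable_fun_ifT => /=.
- exact: measurable_fun_eqr.
(* At base 0 the library power is the indicator of a zero exponent; it is recast as a measurable
   conditional. *)
- under eq_fun do rewrite -[((_ == _)%:R)]/((if _ == _ then 1 else 0)%:R).
  have -> : (fun x => (g x == 0)%:R) = (fun x => if g x == 0 then 1 else 0 : R).
    by apply/funext => x; case: ifP.
  by apply: measurable_fun_ifT => //; exact: measurable_fun_eqr.
- apply: measurableT_comp; first exact: measurable_expR.
  apply: measurable_funM => //.
  by apply: measurableT_comp => //; exact: measurable_ln.
Qed.

Lemma measurable_fun_invr d (T : measurableType d) (f : T -> R) :
  (forall x, 0 <= f x) -> measurable_fun setT f ->
  measurable_fun setT (fun x => (f x)^-1).
Proof.
move=> f0 mf; have -> : (fun x => (f x)^-1) = (fun x => f x `^ (-1)).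
  by apply/funext => x; rewrite powR_inv1.
exact: measurable_fun_powR.
Qed.

(** The common shape of the two terms of [ltfm_kernel]. The exponent is a separate argument because
    it varies with the integration variable. *)
Definition tempered_pow l c z : R :=
  expR (- l * pospart z) * pow0 (pospart z) c.

Lemma tempered_pow_gt0E l c z : 0 < z ->
  tempered_pow l c z = expR (- l * z) * z `^ c.
Proof.
by move=> z0; rewrite /tempered_pow /pow0 /pospart max_l ?ltW// gt_eqF.
Qed.

Lemma tempered_pow_le0 l c z : z <= 0 -> tempered_pow l c z = 0.
Proof. by move=> z0; rewrite /tempered_pow /pow0 /pospart max_r// eqxx mulr0. Qed.

Lemma tempered_pow_ge0 l c z : 0 <= tempered_pow l c z.
Proof.
have [z0|z0] := leP z 0; first by rewrite tempered_pow_le0.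
by rewrite tempered_pow_gt0E// mulr_ge0 ?expR_ge0 ?powR_ge0.
Qed.

(** Source of the self-similarity: rescaling the argument extracts a pure power of [r] and
    multiplies the tempering rate by [r], so that tempering fades as [r] tends to 0. *)
Lemma tempered_powZ l c r z : 0 < r ->
  tempered_pow l c (r * z) = r `^ c * tempered_pow (l * r) c z.
Proof.
move=> r0; have [z0|z0] := leP z 0.
  by rewrite !tempered_pow_le0 ?mulr0// pmulr_rle0.
rewrite !tempered_pow_gt0E ?mulr_gt0// powRM ?ltW// mulrCA.
by congr (_ * (expR _ * _)); ring.
Qed.

(** The exponential factor is at most 1, and (H - 1/A) A = H A - 1. *)
Lemma tempered_pow_powR_le l H A z : 0 < A -> 0 <= l -> 0 < z ->
  tempered_pow l (H - A^-1) z `^ A <= z `^ (H * A - 1).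
Proof.
move=> A0 l0 z0.
have -> : H * A - 1 = (H - A^-1) * A by rewrite mulrBl mulVf// gt_eqF.
rewrite powRrM; apply: ge0_ler_powR; rewrite ?nnegrE ?tempered_pow_ge0 ?powR_ge0 ?(ltW A0)//.
rewrite tempered_pow_gt0E// ler_piMl ?powR_ge0// -expR0 ler_expR mulNr oppr_le0.
by rewrite mulr_ge0// ltW.
Qed.

Lemma measurable_tempered_pow l d (T : measurableType d) (f g : T -> R) :
  measurable_fun setT f -> measurable_fun setT g ->
  measurable_fun setT (fun x => tempered_pow l (f x) (g x)).
Proof.
move=> mf mg.
have mp : measurable_fun setT (fun x => pospart (g x)) by exact: measurable_maxr.
rewrite /tempered_pow /pow0; apply: measurable_funM.
  by apply: measurableT_comp; [exact: measurable_expR|exact: measurable_funM].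
apply: measurable_fun_ifT => //=; first exact: measurable_fun_eqr.
exact: measurable_fun_powR.
Qed.

Definition tempered_incr l c y := tempered_pow l c (1 - y) - tempered_pow l c (- y).

Lemma measurable_tempered_incr l d (T : measurableType d) (f g : T -> R) :
  measurable_fun setT f -> measurable_fun setT g ->
  measurable_fun setT (fun x => tempered_incr l (f x) (g x)).
Proof.
move=> mf mg; apply: measurable_funB; apply: measurable_tempered_pow => //.
  exact: measurable_funB.
exact: measurableT_comp.
Qed.

(** Mean value theorem on [z, 1 + z]: the derivative at x is (c - l x) exp(- l x) x^(c-1), and
    x^(c-1) is nonincreasing because c <= 1. The constant does not involve [l], which is what a
    majorant uniform in the tempering rate requires. *)
Let tempered_pow_MVT l c K z : 0 <= l -> c <= 1 -> `|c| <= K -> 0 < z ->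
  `|tempered_pow l c (1 + z) - tempered_pow l c z| <= (K + 1) * z `^ (c - 1).
Proof.
move=> l0 c1 cK z0.
pose f (x : R) := expR (- l * x) * x `^ c.
have df (x : R) : 0 < x -> is_derive x 1 f
    (expR (- l * x) * (c * x `^ (c - 1)) + x `^ c * (- l * expR (- l * x))).
  move=> x0.
  have h1 : is_derive x 1 (fun x : R => expR (- l * x)) (- l * expR (- l * x)).
    have h : is_derive x 1 (fun x : R => - l * x) (- l).
      by have := is_deriveZ (- l) (is_derive_id x 1); rewrite /GRing.scale/= mulr1.
    have := is_derive1_comp (is_derive_expR (- l * x)) h.
    by rewrite /GRing.scale/= mulrC.
  exact: (is_deriveM h1 (is_derive1_powR c x0)).
have z1 : z < 1 + z by rewrite ltrDr.
have [x xz] : exists2 x, x \in `]z, 1 + z[%R & f (1 + z) - f z =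
    (expR (- l * x) * (c * x `^ (c - 1)) + x `^ c * (- l * expR (- l * x))) * (1 + z - z).
  apply: (MVT z1) => [x|].
    by rewrite in_itv/= => /andP[zx _]; apply: df; exact: lt_trans zx.
  apply: derivable_within_continuous => x; rewrite in_itv/= => /andP[zx _].
  by have [] := df x (lt_le_trans z0 zx).
have x0 : 0 < x by move: xz; rewrite in_itv/= => /andP[zx _]; exact: lt_trans zx.
rewrite !tempered_pow_gt0E ?addr_gt0// -/(f _) -/(f z) addrK mulr1 => ->.
have -> : x `^ c = x * x `^ (c - 1).
  have cE : 1 + (c - 1) = c by ring.
  by rewrite -[in LHS]cE (@powRD _ x 1) ?powRr1 ?(ltW x0)// (gt_eqF x0) implybT.
set e := expR _; set w := x `^ (c - 1).
have -> : e * (c * w) + x * w * (- l * e) = (c * e - l * x * e) * w by ring.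
have w0 : 0 <= w by exact: powR_ge0.
rewrite normrM (ger0_norm w0) ler_pM//.
  have e0 : 0 <= e by exact: expR_ge0.
  have lx0 : 0 <= l * x by rewrite mulr_ge0// ltW.
  have e1 : e <= 1 by rewrite -expR0 ler_expR mulNr oppr_le0.
  (* This comes from l x <= 1 + l x <= exp(l x). *)
  have xe : l * x * e <= 1.
    rewrite /e mulNr expRN ler_pdivrMr ?expR_gt0// mul1r.
    by apply: le_trans (expR_ge1Dx _); rewrite lerDr.
  rewrite (le_trans (ler_normB _ _))// lerD//.
    by rewrite normrM (ger0_norm e0) (le_trans _ cK)// ler_piMr.
  by rewrite ger0_norm// mulr_ge0.
apply: le0_ler_powR => //; first by rewrite subr_le0.
by move: xz; rewrite in_itv/= => /andP[/ltW].
Qed.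

(** Four ranges of [y]. For y >= 1 both terms vanish; for 0 <= y < 1 only the first survives. For -1
    <= y < 0 the terms are bounded separately. For y < -1 the mean value bound supplies the decay
    exponent (H - 1/A - 1) A = -1 - A (1 - H), at most -1 - a (1 - H). *)
Lemma tempered_incr_powR_le l H a A y : 0 < a -> a <= A <= 2 -> 0 < H < 1 -> 0 <= l ->
  `|tempered_incr l (H - A^-1) y| `^ A <=
  piecewise_pow (H * a / 2 - 1) (- 1 - a * (1 - H)) (1 - y) +
  (2 + a^-1) ^+ 2 * piecewise_pow (H * a / 2 - 1) (- 1 - a * (1 - H)) (- y).
Proof.
move=> a0 /andP[aA A2] /andP[H0 H1] l0.
(* Since H a < 2, halving H a makes [p] negative while keeping it above -1 and below H A - 1. Then
   s^p >= 1 on ]0, 1], so that constants can be absorbed into s^p. *)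
set p := _ - 1; set q := -1 - _; set B := _ ^+ 2.
have A0 : 0 < A by exact: lt_le_trans aA.
have ai0 : 0 < a^-1 by rewrite invr_gt0.
have B4 : 4 <= B by rewrite /B; nra.
have HA0 : 0 < H * A by exact: mulr_gt0.
have HaA : H * a <= H * A by rewrite ler_pM2l.
have Ha0 : 0 < H * a by exact: mulr_gt0.
have pe : p <= H * A - 1 by rewrite /p; lra.
have Ha2 : H * a < 2 by nra.
have p0 : p <= 0 by rewrite /p; lra.
have HA2 : H * A < 2 by nra.
rewrite /tempered_incr; have [y1|y1] := leP 1 y.
  rewrite !tempered_pow_le0 ?oppr_le0 ?subr_le0//; last lra.
  rewrite subrr normr0 powR0 ?gt_eqF// addr_ge0 ?piecewise_pow_ge0//.
  by rewrite mulr_ge0 ?piecewise_pow_ge0//; lra.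
have [y0|y0] := leP 0 y.
  rewrite (@tempered_pow_le0 _ _ (- y)) ?oppr_le0// subr0 ger0_norm ?tempered_pow_ge0//.
  rewrite (@piecewise_pow_le0 _ _ _ (- y)) ?oppr_le0// mulr0 addr0.
  rewrite piecewise_pow_le1 ?subr_gt0// ?gerBl//.
  apply: le_trans (tempered_pow_powR_le _ _ _ _) _ => //; first by rewrite subr_gt0.
  by apply: ger_powR => //; rewrite subr_gt0 y1 gerBl.
move: y0; rewrite -oppr_gt0; move: (- y) => s s0.
rewrite -[leLHS]add0r lerD ?piecewise_pow_ge0//.
have [s1|s1] := leP s 1.
  rewrite piecewise_pow_le1//.
  have sp1 : 1 <= s `^ p by have := le0_ler_powR p0 s0 s1; rewrite powR1.
  have h1 := @tempered_pow_powR_le l H A _ A0 l0 s0.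
  have h2 := @tempered_pow_powR_le l H A _ A0 l0 (addr_gt0 ltr01 s0).
  set u := tempered_pow _ _ _ in h2 *; set v := tempered_pow _ _ _ in h1 *.
  have u0 : 0 <= u by exact: tempered_pow_ge0.
  have v0 : 0 <= v by exact: tempered_pow_ge0.
  (* For nonnegative [u] and [v] the difference is at most the larger of the two; this works for A
     below 1 as well as above. *)
  have uv : `|u - v| `^ A <= u `^ A + v `^ A.
    have [uv|uv] := leP v u.
      rewrite ger0_norm ?subr_ge0// -[leLHS]addr0 lerD ?powR_ge0//.
      by apply: ge0_ler_powR; rewrite ?nnegrE ?subr_ge0// ?(ltW A0)// gerBl.
    rewrite ltr0_norm ?subr_lt0// -[leLHS]add0r lerD ?powR_ge0//.
    by apply: ge0_ler_powR; rewrite ?nnegrE ?opprB ?subr_ge0 ?(ltW A0) ?(ltW uv)// gerBl.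
  have h3 : (1 + s) `^ (H * A - 1) <= 2.
    apply: (@le_trans _ _ ((1 + s) `^ 1)); first by apply: ler_powR; [rewrite lerDl ltW|clear -HA2; lra].
    by rewrite powRr1; clear -s0 s1; lra.
  have h4 : s `^ (H * A - 1) <= s `^ p by apply: ger_powR => //; rewrite s0.
  (* The two terms contribute at most 2 + s^p, and 1 <= s^p; the constant [B] is at least 4. *)
  apply: (@le_trans _ _ (4 * s `^ p)); last by rewrite ler_pM2r ?powR_gt0.
  apply: (le_trans uv); apply: le_trans (lerD (le_trans h2 h3) (le_trans h1 h4)) _.
  by move: (s `^ p) sp1 => w w1; clear -w1; lra.
rewrite piecewise_pow_gt1//.
have Ai : A^-1 <= a^-1 by rewrite lef_pV2.
have Ai0 : 0 < A^-1 by rewrite invr_gt0.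
(* With this [K] the mean value constant is 2 + 1/a; as it exceeds 1 and A <= 2, its power A is at
   most its square [B]. *)
have cK : `|H - A^-1| <= 1 + a^-1 by rewrite ler_norml; lra.
have := @tempered_pow_MVT l (H - A^-1) _ s l0 _ cK s0.
move=> /(_ ltac:(lra)) h.
apply: (@le_trans _ _ (((1 + a^-1 + 1) * s `^ (H - A^-1 - 1)) `^ A)).
  by apply: ge0_ler_powR; rewrite ?nnegrE ?(ltW A0)// mulr_ge0 ?powR_ge0//; lra.
rewrite powRM ?powR_ge0//; last lra.
rewrite -powRrM ler_pM ?powR_ge0//.
  rewrite /B -powR_mulrn; last lra.
  by rewrite (_ : 1 + a^-1 + 1 = 2 + a^-1); [apply: ler_powR; lra|ring].
apply: ler_powR; first exact: ltW.
have -> : (H - A^-1 - 1) * A = - 1 - A * (1 - H).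
  by field; rewrite gt_eqF.
by rewrite /q; nra.
Qed.

End tempered_power.

(** * The energy of a tempered increment *)

Section increment_energy.
Context {R : realType}.
Notation mu := (@lebesgue_measure R).
Implicit Types (a l c y H theta : R) (A : R -> R).

(** If the limit base is positive, continuity of exp and ln suffices. If it is 0, the positive lower
    bound [q] on the exponents forces the powers to 0. *)
Lemma cvg_powR (x p : R^nat) (x0 p0 q : R) : 0 < q ->
  (forall n, 0 <= x n) -> (forall n, q <= p n) ->
  x n @[n --> \oo] --> x0 -> p n @[n --> \oo] --> p0 ->
  x n `^ p n @[n --> \oo] --> x0 `^ p0.
Proof.
move=> q0 x_ge0 pq xx0 pp0.
have x0_ge0 : 0 <= x0.
  have <- : limn x = x0 by apply/cvg_lim.
  by apply: limr_ge; [apply/cvg_ex; exists x0|exact: nearW].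
have qp0 : q <= p0.
  have <- : limn p = p0 by apply/cvg_lim.
  by apply: limr_ge; [apply/cvg_ex; exists p0|exact: nearW].
have [x00|x00] := eqVneq x0 0.
  rewrite x00 powR0; last by rewrite gt_eqF// (lt_le_trans q0).
  apply/cvgrPdist_le => e e0.
  (* A base below 1 gives x^p <= x^q, and a base below e^(1/q) gives x^q <= e. *)
  have e'0 : 0 < Num.min 1 (e `^ q^-1) by rewrite lt_min ltr01 powR_gt0.
  move/cvgrPdist_lt : xx0 => /(_ _ e'0); apply: filterS => n.
  rewrite x00 !sub0r !normrN !ger0_norm ?powR_ge0// lt_min => /andP[x1 xe].
  have [->|xn0] := eqVneq (x n) 0.
    by rewrite powR0 ?ltW// gt_eqF// (lt_le_trans q0).
  have xn_gt0 : 0 < x n by rewrite lt_neqAle eq_sym xn0 x_ge0.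
  apply: (@le_trans _ _ (x n `^ q)).
    by apply: ger_powR; rewrite ?xn_gt0 ?(ltW x1).
  have -> : e = (e `^ q^-1) `^ q.
    by rewrite -powRrM mulVf ?gt_eqF// powRr1// ltW.
  by apply: ge0_ler_powR; rewrite ?nnegrE ?powR_ge0 ?(ltW q0) ?(ltW xe).
have x0_gt0 : 0 < x0 by rewrite lt_neqAle eq_sym x00.
rewrite {2}/powR (negbTE x00).
apply: (@cvg_trans _ (expR (p n * ln (x n)) @[n --> \oo])).
  apply: near_eq_cvg; move/cvgrPdist_lt : xx0 => /(_ _ x0_gt0).
  apply: filterS => n h; rewrite /powR gt_eqF//.
  by move: h; rewrite ltr_norml => /andP[_]; lra.
apply: continuous_cvg; first exact: continuous_expR.
apply: cvgM => //.
by apply: continuous_cvg => //; exact: continuous_ln.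
Qed.

Lemma cvg_powR_exponent (z : R) (p : R^nat) (p0 : R) : 0 < z ->
  p n @[n --> \oo] --> p0 -> z `^ p n @[n --> \oo] --> z `^ p0.
Proof.
move=> z0 pp0; rewrite /powR gt_eqF//.
apply: continuous_cvg; first exact: continuous_expR.
by apply: cvgM => //; exact: cvg_cst.
Qed.

Lemma cvg_tempered_pow (l c : R^nat) (l0 c0 z : R) :
  l n @[n --> \oo] --> l0 -> c n @[n --> \oo] --> c0 ->
  tempered_pow (l n) (c n) z @[n --> \oo] --> tempered_pow l0 c0 z.
Proof.
move=> ll0 cc0; have [z0|z0] := leP z 0.
  under eq_cvg do rewrite tempered_pow_le0//.
  by rewrite tempered_pow_le0//; exact: cvg_cst.
under eq_cvg do rewrite tempered_pow_gt0E//.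
rewrite tempered_pow_gt0E//; apply: cvgM; last exact: cvg_powR_exponent.
apply: continuous_cvg; first exact: continuous_expR.
by apply: cvgM; [exact: cvgN|exact: cvg_cst].
Qed.

Lemma cvg_tempered_incr (l c : R^nat) (l0 c0 y : R) :
  l n @[n --> \oo] --> l0 -> c n @[n --> \oo] --> c0 ->
  tempered_incr (l n) (c n) y @[n --> \oo] --> tempered_incr l0 c0 y.
Proof. by move=> ll0 cc0; apply: cvgB; exact: cvg_tempered_pow. Qed.

(** The exponent J in the characteristic function exp(-J) of a rescaled increment, with [A] the
    rescaled stability index and [l] the rescaled tempering rate. For l = 0, a constant index and
    theta = 1 it is the integral appearing in [Flim]. *)
Definition incr_energy H l A theta : \bar R :=
  (\int[mu]_y (`|theta * tempered_incr l (H - (A y)^-1) y| `^ A y)%:E)%E.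

(** It involves neither the rate nor the index function, hence serves all scales at once. *)
Definition incr_majorant H a y : R :=
  piecewise_pow (H * a / 2 - 1) (- 1 - a * (1 - H)) (1 - y) +
  (2 + a^-1) ^+ 2 * piecewise_pow (H * a / 2 - 1) (- 1 - a * (1 - H)) (- y).

Lemma measurable_incr_majorant H a : measurable_fun [set: R] (incr_majorant H a).
Proof.
apply: measurable_funD.
  by apply: measurableT_comp; [exact: measurable_piecewise_pow|exact: measurable_funB].
apply: measurable_funM => //.
by apply: measurableT_comp; [exact: measurable_piecewise_pow|].
Qed.

Lemma incr_majorant_ge0 H a y : 0 <= incr_majorant H a y.
Proof.
apply: addr_ge0; first exact: piecewise_pow_ge0.
by apply: mulr_ge0; [exact: sqr_ge0|exact: piecewise_pow_ge0].
Qed.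

Lemma integrable_incr_majorant H a : 0 < a -> 0 < H < 1 ->
  mu.-integrable setT (EFin \o incr_majorant H a).
Proof.
move=> a0 /andP[H0 H1].
have p1 : -1 < H * a / 2 - 1 by rewrite ltrBrDl subrr divr_gt0 ?mulr_gt0.
have q1 : - 1 - a * (1 - H) < -1 by rewrite ltrBlDr ltrDl mulr_gt0 ?subr_gt0.
have Ioo := integral_piecewise_pow_lty p1 q1.
pose f z := (piecewise_pow (H * a / 2 - 1) (- 1 - a * (1 - H)) z)%:E.
have mf : measurable_fun [set: R] f.
  by apply/measurable_EFinP; exact: measurable_piecewise_pow.
have f0 z : (0 <= f z)%E by rewrite lee_fin piecewise_pow_ge0.
have mfN : measurable_fun [set: R] (fun y => f (- y)) by exact: measurableT_comp.
have mfB : measurable_fun [set: R] (fun y => f (1 - y)).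
  by apply: measurableT_comp => //; exact: measurable_funB.
apply/integrableP; split.
  by apply/measurable_EFinP; exact: measurable_incr_majorant.
have -> : (\int[mu]_y `|(EFin \o incr_majorant H a) y|)%E =
    (\int[mu]_y (f (1 - y)%R + ((2 + a^-1) ^+ 2)%:E * f (- y)%R))%E.
  apply: eq_integral => y _ /=.
  by rewrite ger0_norm ?incr_majorant_ge0.
rewrite ge0_integralD//; last 2 first.
- by move=> y _; rewrite mule_ge0// lee_fin sqr_ge0.
- exact: measurable_funeM.
rewrite ge0_integralZl//; last by rewrite lee_fin sqr_ge0.
rewrite lte_add_pinfty//.
  (* A reflection turns the argument into 1 + y, and a translation removes the 1. *)
  have -> : (\int[mu]_y f (1 - y)%R = \int[mu]_y f y)%E.
    rewrite (ge0_integral_oppr mfB)//.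
    rewrite [RHS](@ge0_integral_affine _ _ 1 1)// mul1e.
    by apply: eq_integral => y _; rewrite opprK mul1r.
  exact: Ioo.
rewrite -(ge0_integral_oppr mf)// lte_mul_pinfty// lee_fin.
exact: sqr_ge0.
Qed.

(** The factor |theta|^(A y) is dominated by |theta|^a when |theta| <= 1 and by |theta|^2 otherwise;
    the sum covers both. *)
Let majorant_bound H a A l theta y : 0 < a -> (forall y, a <= A y <= 2) ->
  0 < H < 1 -> 0 <= l ->
  `|theta * tempered_incr l (H - (A y)^-1) y| `^ A y <=
  (`|theta| `^ a + `|theta| `^ 2) * incr_majorant H a y.
Proof.
move=> a0 aA H01 l0; have /andP[aAy Ay2] := aA y.
rewrite normrM powRM// ler_pM ?powR_ge0//; last exact: tempered_incr_powR_le.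
have [t1|t1] := leP `|theta| 1.
  have [->|t0] := eqVneq theta 0.
    by rewrite normr0 powR0 ?addr_ge0 ?powR_ge0// gt_eqF// (lt_le_trans a0).
  rewrite -[leLHS]addr0 lerD ?powR_ge0//.
  by apply: ger_powR => //; rewrite normr_gt0 t0.
by rewrite -[leLHS]add0r lerD ?powR_ge0//; apply: ler_powR => //; exact: ltW.
Qed.

Lemma measurable_incr_integrand H l a A theta : measurable_fun [set: R] A ->
  0 < a -> (forall y, a <= A y <= 2) -> measurable_fun [set: R]
    (fun y => (`|theta * tempered_incr l (H - (A y)^-1) y| `^ A y)%:E).
Proof.
move=> mA a0 aA; apply/measurable_EFinP; apply: measurable_fun_powR => //.
apply: measurableT_comp => //; apply: measurable_funM => //.
apply: measurable_tempered_incr => //; apply: measurable_funB => //.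
apply: measurable_fun_invr => // y.
by have /andP[aAy _] := aA y; exact: le_trans (ltW a0) aAy.
Qed.

Lemma incr_energy_ge0 H l A theta : (0 <= incr_energy H l A theta)%E.
Proof. by apply: integral_ge0 => y _; rewrite lee_fin powR_ge0. Qed.

(** For small theta this is O(|theta|^a), uniformly in the rate and the index; it is used later
    against the singularity u^(-g-1) at 0. *)
Lemma incr_energy_le H l a A theta : 0 < a -> (forall y, a <= A y <= 2) ->
  measurable_fun [set: R] A -> 0 < H < 1 -> 0 <= l ->
  (incr_energy H l A theta <=
   (`|theta| `^ a + `|theta| `^ 2)%:E * \int[mu]_y (incr_majorant H a y)%:E)%E.
Proof.
move=> a0 aA mA H01 l0.
have mM : measurable_fun [set: R] (fun y => (incr_majorant H a y)%:E).
  by apply/measurable_EFinP; exact: measurable_incr_majorant.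
have t0 : 0 <= `|theta| `^ a + `|theta| `^ 2 by rewrite addr_ge0 ?powR_ge0.
rewrite -ge0_integralZl//; last by move=> y _; rewrite lee_fin incr_majorant_ge0.
apply: ge0_le_integral => //.
- exact: (measurable_incr_integrand _ _ _ mA a0).
- exact: measurable_funeM.
- by move=> y _; rewrite -EFinM lee_fin majorant_bound.
Qed.

Lemma incr_energy_lty H l a A theta : 0 < a -> (forall y, a <= A y <= 2) ->
  measurable_fun [set: R] A -> 0 < H < 1 -> 0 <= l ->
  (incr_energy H l A theta < +oo)%E.
Proof.
move=> a0 aA mA H01 l0; apply: le_lt_trans (incr_energy_le _ a0 aA mA H01 l0) _.
rewrite lte_mul_pinfty ?lee_fin ?addr_ge0 ?powR_ge0//.
have /integrableP[_] := integrable_incr_majorant a0 H01.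
by under eq_integral do rewrite /= ger0_norm ?incr_majorant_ge0//.
Qed.

(** Dominated convergence: the tempering disappears in the limit and the index freezes at [A0]. The
    bound a <= A n y supplies the positive lower bound on exponents needed where the increment tends
    to 0. *)
Lemma cvg_incr_energy H (l : R^nat) (A : nat -> R -> R) a (A0 : R) theta :
  0 < a -> (forall n y, a <= A n y <= 2) -> a <= A0 <= 2 ->
  (forall n, measurable_fun [set: R] (A n)) -> 0 < H < 1 ->
  (forall n, 0 <= l n) -> l n @[n --> \oo] --> 0 ->
  (forall y, A n y @[n --> \oo] --> A0) ->
  incr_energy H (l n) (A n) theta @[n --> \oo] --> incr_energy H 0 (cst A0) theta.
Proof.
move=> a0 aA aA0 mA H01 l0 ll0 AA0.
pose f_ n y := (`|theta * tempered_incr (l n) (H - (A n y)^-1) y| `^ A n y)%:E.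
pose f y := (`|theta * tempered_incr 0 (H - A0^-1) y| `^ A0)%:E.
pose g y := ((`|theta| `^ a + `|theta| `^ 2) * incr_majorant H a y)%:E.
have mf_ n : measurable_fun [set: R] (f_ n).
  exact: (measurable_incr_integrand _ _ _ (mA n) a0).
have f_f y : [set: R] y -> f_ n y @[n --> \oo] --> f y.
  move=> _; apply: cvg_EFin; first exact: nearW.
  apply: (cvg_powR a0) => //.
  - by move=> n; have /andP[] := aA n y.
  - apply: cvg_norm; apply: cvgM; first exact: cvg_cst.
    apply: cvg_tempered_incr => //; apply: cvgB; first exact: cvg_cst.
    by apply: cvgV => //; rewrite gt_eqF// (lt_le_trans a0)//; case/andP: aA0.
have fing y : [set: R] y -> g y \is a fin_num by [].
have ig : mu.-integrable [set: R] g.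
  have := integrable_incr_majorant a0 H01.
  move=> /(integrableZl measurableT (`|theta| `^ a + `|theta| `^ 2)).
  by apply: eq_integrable => // y _; rewrite /= EFinM.
have f_g n y : [set: R] y -> (`|f_ n y| <= g y)%E.
  move=> _; rewrite gee0_abs ?lee_fin ?powR_ge0//.
  by apply: majorant_bound => // y'.
exact: (dominated_cvg (mu := mu) measurableT mf_ f_f fing ig f_g).
Qed.

End increment_energy.

(** * Characteristic function of an increment *)

Section kernel_increment.
Context {R : realType}.
Notation mu := (@lebesgue_measure R).
Variables (H a lambda : R) (alpha : R -> R).
Hypotheses (a0 : 0 < a) (halpha : forall x, a <= alpha x <= 2).
Hypotheses (calpha : continuous alpha) (H01 : 0 < H < 1) (lambda0 : 0 <= lambda).

Let malpha : measurable_fun [set: R] alpha.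
Proof. exact: continuous_measurable_fun. Qed.

Let measurable_alphaV : measurable_fun [set: R] (fun x => (alpha x)^-1).
Proof.
apply: measurable_fun_invr => // x.
by have /andP[aAx _] := halpha x; exact: le_trans (ltW a0) aAx.
Qed.

Let kernel := ltfm_kernel H alpha lambda.

Lemma measurable_ltfm_kernel t : measurable_fun [set: R] (kernel t).
Proof.
apply: measurable_funB; apply: measurable_tempered_pow => //;
  by exact: measurable_funB.
Qed.

Lemma ltfm_kernelB t r x : kernel (t + r) x - kernel t x =
  tempered_pow lambda (H - (alpha x)^-1) (t + r - x) -
  tempered_pow lambda (H - (alpha x)^-1) (t - x).
Proof. by rewrite /kernel /ltfm_kernel opprB addrA subrK. Qed.

(** Substitute x = t + r y. Scaling extracts r^(H - 1/A), whose power A is r^(H A - 1); the Jacobian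
    [r] completes it to (r^H)^A, which is absorbed into theta although A depends on y. *)
Lemma integral_kernel_increment t r theta : 0 < r ->
  (\int[mu]_x (`|theta * (kernel (t + r) x - kernel t x)| `^ alpha x)%:E =
   incr_energy H (lambda * r) (fun y => alpha (t + r * y)%R) (r `^ H * theta))%E.
Proof.
move=> r0.
have mf : measurable_fun [set: R]
    (fun x => (`|theta * (kernel (t + r) x - kernel t x)| `^ alpha x)%:E).
  apply/measurable_EFinP; apply: measurable_fun_powR => //.
  apply: measurableT_comp => //; apply: measurable_funM => //.
  by apply: measurable_funB; exact: measurable_ltfm_kernel.
rewrite (ge0_integral_affine_in t r0 mf); last by move=> x; rewrite lee_fin powR_ge0.
apply: eq_integral => y _; rewrite -EFinM; congr EFin.
set A := alpha _; have A0 : 0 < A.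
  by apply: (lt_le_trans a0); have /andP[] := halpha (t + r * y).
rewrite ltfm_kernelB -/A.
have -> : t + r - (t + r * y) = r * (1 - y) by ring.
have -> : t - (t + r * y) = r * - y by ring.
rewrite !tempered_powZ// -mulrBr -/(tempered_incr _ _ _).
rewrite [in LHS]normrM normrM (ger0_norm (powR_ge0 _ _)) !normrM.
rewrite (ger0_norm (powR_ge0 _ _)) !powRM ?mulr_ge0 ?powR_ge0 ?normr_ge0//.
rewrite -!powRrM.
have -> : r `^ (H * A) = r * r `^ ((H - A^-1) * A).
  have HA : 1 + (H - A^-1) * A = H * A by field; rewrite gt_eqF.
  by rewrite -HA (@powRD _ r 1) ?powRr1 ?(ltW r0)// (gt_eqF r0) implybT.
by ring.
Qed.

Lemma integrable_kernel_increment t r : 0 < r ->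
  multistable_integrable alpha (fun x => kernel (t + r) x - kernel t x).
Proof.
move=> r0; split.
  by apply: measurable_funB; exact: measurable_ltfm_kernel.
have := integral_kernel_increment t 1 r0.
under eq_integral do rewrite mul1r.
move=> ->; apply: (incr_energy_lty _ a0) => //.
- apply: (measurableT_comp malpha).
  by apply: measurable_funD => //; exact: measurable_funM.
- by rewrite mulr_ge0// ltW.
Qed.

(** The kernel vanishes at time 0, so the kernel at [t] is, up to sign, an increment between 0 and
    [t]. *)
Lemma integrable_ltfm_kernel t : multistable_integrable alpha (kernel t).
Proof.
have k0 x : kernel 0 x = 0 by rewrite /kernel /ltfm_kernel sub0r subrr.
have [t0|t0|->] := ltgtP t 0.
- have [mk ik] := @integrable_kernel_increment t (- t) ltac:(by rewrite oppr_gt0).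
  split; first exact: measurable_ltfm_kernel.
  by move: ik; under eq_integral do rewrite subrr k0 sub0r normrN.
- have [mk ik] := @integrable_kernel_increment 0 t t0.
  split; first exact: measurable_ltfm_kernel.
  by move: ik; under eq_integral do rewrite add0r k0 subr0.
- split; first exact: measurable_ltfm_kernel.
  rewrite integral0_eq// => x _; rewrite k0 normr0 powR0//.
  by have /andP[aA _] := halpha x; rewrite gt_eqF// (lt_le_trans a0).
Qed.

End kernel_increment.

(** * From the multistable integral to the law of an increment of the process *)

Section characteristic_function.
Context {R : realType} {d : measure_display} {T : measurableType d}.
Variable P : probability T R.
Notation mu := (@lebesgue_measure R).

Lemma measurable_cos : measurable_fun [set: R] (@cos R).
Proof. by apply: continuous_measurable_fun; exact: continuous_cos. Qed.

Lemma integrable_bounded (f : T -> R) (M : R) : measurable_fun setT f ->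
  (forall w, `|f w| <= M) -> P.-integrable setT (EFin \o f).
Proof.
move=> mf fM; apply: (@le_integrable _ _ _ P setT measurableT _ (EFin \o cst M)).
- exact/measurable_EFinP.
- by move=> w _ /=; rewrite lee_fin (le_trans (fM w))// ler_norm.
- exact: finite_measure_integrable_cst.
Qed.

Lemma LTFmSM_charfun (H a lambda : R) (alpha : R -> R) (X : R -> {RV P >-> R})
    (t r theta : R) :
  0 < a -> (forall x, a <= alpha x <= 2) -> continuous alpha ->
  0 < H < 1 -> 0 <= lambda -> LTFmSM H alpha lambda X -> 0 < r ->
  (\int[P]_w (cos (theta * (X (t + r) w - X t w)))%:E =
   (expR (- fine (incr_energy H (lambda * r) (fun y => alpha (t + r * y))
                   (r `^ H * theta))))%:E)%E.
Proof.
move=> a0 halpha calpha H01 lambda0 [I II XI] r0.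
(* The joint characteristic function at the times t + r and t, with coefficients theta and -theta,
   is that of the increment; only its real part is used. *)
pose th (k : 'I_2) := if val k == 0%N then theta else - theta.
pose f (k : 'I_2) := ltfm_kernel H alpha lambda (if val k == 0%N then t + r else t).
have fi k : multistable_integrable alpha (f k).
  exact: (integrable_ltfm_kernel a0 halpha calpha H01 lambda0).
have mI k : measurable_fun setT (I (f k)) by exact: measurable_funPT.
have : fine ('E_P[fun w => cos (\sum_(k < 2) th k * I (f k) w)])%E =
    expR (- fine (\int[mu]_x (`|\sum_(k < 2) th k * f k x| `^ alpha x)%:E)%E).
  exact: (congr1 (@complex.Re R) (II 2%N th f fi)).
have -> : (\int[mu]_x (`|\sum_(k < 2) th k * f k x| `^ alpha x)%:E =
    incr_energy H (lambda * r) (fun y => alpha (t + r * y)%R) (r `^ H * theta))%E.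
  rewrite -(integral_kernel_increment H lambda a0 halpha calpha)//; apply: eq_integral => x _.
  by rewrite !big_ord_recl big_ord0 /th /f/= addr0 mulNr -mulrBr.
move=> <-; rewrite expectation.unlock fineK; last first.
  apply: (integrable_fin_num measurableT); apply: (@integrable_bounded _ 1).
    apply: measurableT_comp; first exact: measurable_cos.
    by apply: measurable_sum => k; exact: measurable_funM.
  by move=> w; rewrite ler_norml cos_geN1 cos_le1.
(* Each [X t] agrees with its integral only almost everywhere, so the exceptional sets of the two
   times are combined. *)
apply: ae_eq_integral => //.
- apply/measurable_EFinP; apply: measurableT_comp; first exact: measurable_cos.
  by apply: measurable_funM => //; exact: measurable_funB.
- apply/measurable_EFinP; apply: measurableT_comp; first exact: measurable_cos.
  by apply: measurable_sum => k; exact: measurable_funM.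
- have := XI t; apply: filterS2 (XI (t + r)) => w X1 X2 _.
  by rewrite !big_ord_recl big_ord0 /th /f/= addr0 mulNr -mulrBr X1 X2.
Qed.

End characteristic_function.

(** * Absolute moments from the characteristic function *)

Section sine_moment.
Context {R : realType}.
Notation mu := (@lebesgue_measure R).
Implicit Types g u y : R.

(** Extension by 0 to the whole line, so that the affine change of variables applies without
    tracking domains. *)
Definition half_line_pow g u : R := if 0 < u then u `^ (- g - 1) else 0.

Lemma half_line_pow_ge0 g u : 0 <= half_line_pow g u.
Proof. by rewrite /half_line_pow; case: ifP => // _; exact: powR_ge0. Qed.

Lemma measurable_half_line_pow g : measurable_fun [set: R] (half_line_pow g).
Proof.
by apply: measurable_fun_ifT => //; exact: measurable_fun_ltr.
Qed.

Lemma half_line_powM g c u : 0 < c ->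
  half_line_pow g (c * u) = c `^ (- g - 1) * half_line_pow g u.
Proof.
move=> c0; rewrite /half_line_pow pmulr_rgt0//.
by case: ifP => u0; rewrite ?mulr0// powRM ?ltW.
Qed.

Lemma integral_half_line (f : R -> R) g :
  (\int[mu]_(u in `]0%R, +oo[) (u `^ (- g - 1) * f u)%:E =
   \int[mu]_u (half_line_pow g u * f u)%:E)%E.
Proof.
rewrite integral_mkcond; apply: eq_integral => u _.
rewrite patchE /half_line_pow; case: ifPn => [|h]; first by rewrite inE/= in_itv/= andbT => ->.
case: ifPn => u0; last by rewrite mul0r.
by move: h; rewrite notin_setE/= in_itv/= u0.
Qed.

Definition sine_integral g : \bar R :=
  (\int[mu]_u (half_line_pow g u * sin u ^+ 2)%:E)%E.

Lemma measurable_sin : measurable_fun [set: R] (@sin R).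
Proof. by apply: continuous_measurable_fun; exact: continuous_sin. Qed.

Lemma normr_sin_le u : `|sin u| <= `|u|.
Proof.
wlog u0 : u / 0 < u.
  move=> h; have [u0|u0|->] := ltgtP u 0; [|exact: h|by rewrite sin0 normr0].
  by have := h (- u); rewrite sinN !normrN; apply; rewrite oppr_gt0.
have : forall x, x \in `]0, u[%R -> is_derive x 1 sin (cos x).
  by move=> x _; exact: is_derive_sin.
move=> /(MVT u0)[|c _].
  by apply: continuous_subspaceT => x; exact: continuous_sin.
rewrite sin0 !subr0 => ->; rewrite normrM ler_piMl//.
by rewrite ler_norml cos_geN1 cos_le1.
Qed.

(** Near 0 the bound |sin u| <= |u| leaves u^(1-g), integrable since g < 2; beyond 1 the sine is
    bounded and u^(-g-1) is integrable since g > 0. *)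
Lemma sine_integral_lty g : 0 < g < 2 -> (sine_integral g < +oo)%E.
Proof.
move=> /andP[g0 g2].
have p1 : -1 < 2 - g - 1 by lra.
have q1 : - g - 1 < -1 by lra.
apply: le_lt_trans (integral_piecewise_pow_lty p1 q1).
apply: ge0_le_integral => //.
- by move=> u _; rewrite lee_fin mulr_ge0 ?half_line_pow_ge0 ?sqr_ge0.
- apply/measurable_EFinP; apply: measurable_funM.
    exact: measurable_half_line_pow.
  by apply: measurable_funX; exact: measurable_sin.
- by apply/measurable_EFinP; exact: measurable_piecewise_pow.
- move=> u _; rewrite lee_fin /half_line_pow; case: ifPn => u0; last first.
    by rewrite mul0r piecewise_pow_ge0.
  have [u1|u1] := leP u 1.
    rewrite piecewise_pow_le1//.
    have -> : 2 - g - 1 = - g - 1 + 2%:R by ring.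
    rewrite (@powRD _ u (- g - 1) 2%:R) ?(gt_eqF u0) ?implybT// powR_mulrn ?(ltW u0)//.
    rewrite ler_wpM2l ?powR_ge0// -real_normK ?num_real// -(real_normK (num_real u)).
    by rewrite lerXn2r ?nnegrE// normr_sin_le.
  by rewrite piecewise_pow_gt1// ler_piMr ?powR_ge0// sin2cos2 gerBl sqr_ge0.
Qed.

(** On [1/2, 1] the power is at least 1, and sin u >= sin (1/2) > 0 because this interval lies below
    pi/2, where the sine increases. *)
Lemma sine_integral_gt0 g : 0 < g -> (0 < sine_integral g)%E.
Proof.
move=> g0.
have pi2 := pi_ge2 R.
have inpi (x : R) : 0 <= x -> x <= 1 -> x \in `[- (pi / 2), pi / 2].
  by move=> x0 x1; rewrite in_itv/=; apply/andP; split; lra.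
have h0 : 0 < 2^-1 :> R by rewrite invr_gt0.
have h1 : 2^-1 < 1 :> R by rewrite invf_lt1// ltr1n.
have s0 : 0 < sin (2^-1 : R).
  rewrite -(@sin0 R) ltr_sin//; first by apply: inpi.
  by apply: inpi; exact: ltW.
apply: (@lt_le_trans _ _ (\int[mu]_(u in `[2^-1%R, 1%R]) (sin (2^-1 : R) ^+ 2)%:E)%E).
  rewrite integral_cst//= lebesgue_measure_itv/= lte_fin h1 -EFinB -EFinM lte_fin.
  by rewrite mulr_gt0 ?exprn_gt0// subr_gt0.
rewrite integral_mkcond; apply: ge0_le_integral => //.
- by move=> u _; apply: erestrict_ge0 => v _; rewrite lee_fin sqr_ge0.
- by apply/(measurable_restrictT _ _).1.
- apply/measurable_EFinP; apply: measurable_funM.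
    exact: measurable_half_line_pow.
  by apply: measurable_funX; exact: measurable_sin.
move=> u _; rewrite patchE; case: ifPn => [|_]; last first.
  by rewrite lee_fin mulr_ge0 ?half_line_pow_ge0 ?sqr_ge0.
rewrite inE/= in_itv/= => /andP[u2 u1]; rewrite lee_fin.
have u0 : 0 < u by lra.
rewrite /half_line_pow u0 -[leLHS]mul1r ler_pM ?sqr_ge0//.
  by have := @le0_ler_powR R (- g - 1) u 1 ltac:(lra) u0 u1; rewrite powR1.
rewrite lerXn2r ?nnegrE ?(ltW s0)//.
  by rewrite sin_ge0_pi// (ltW u0)/=; lra.
have [->//|u2'] := eqVneq u 2^-1.
rewrite ltW// ltr_sin; first by rewrite lt_neqAle eq_sym u2'.
- by apply: inpi; exact: ltW.
- by apply: inpi; rewrite ?(ltW u0).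
Qed.

(** Rescale the sine integral by |y|: the Jacobian and the power leave |y|^(-g), and sin^2 ignores
    the sign of [y]. For y = 0 both sides vanish. *)
Lemma normr_powR_sine_integral g y : 0 < g ->
  ((`|y| `^ g)%:E * sine_integral g =
   \int[mu]_u (half_line_pow g u * sin (u * y) ^+ 2)%:E)%E.
Proof.
move=> g0; have [->|y0] := eqVneq y 0.
  rewrite normr0 powR0 ?gt_eqF// mul0e integral0_eq// => u _.
  by rewrite mulr0 sin0 expr0n mulr0.
have ny : 0 < `|y| by rewrite normr_gt0.
have mf : measurable_fun [set: R] (fun u => (half_line_pow g u * sin u ^+ 2)%:E).
  apply/measurable_EFinP; apply: measurable_funM.
    exact: measurable_half_line_pow.
  by apply: measurable_funX; exact: measurable_sin.
rewrite /sine_integral (ge0_integral_affine_in 0 ny mf); last first.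
  by move=> u; rewrite lee_fin mulr_ge0 ?half_line_pow_ge0 ?sqr_ge0.
have ml : measurable_fun [set: R] (fun u => 0 + `|y| * u).
  by apply: measurable_funD => //; exact: measurable_funM.
have mfl : measurable_fun [set: R]
    (fun u => (`|y|%:E * (half_line_pow g (0 + `|y| * u) * sin (0 + `|y| * u) ^+ 2)%:E)%E).
  apply: measurable_funeM; apply/measurable_EFinP; apply: measurable_funM.
    by apply: measurableT_comp => //; exact: measurable_half_line_pow.
  by apply: measurable_funX; apply: measurableT_comp => //; exact: measurable_sin.
rewrite -(ge0_integralZl mu measurableT mfl); last 2 first.
- by move=> u _; rewrite mule_ge0 ?lee_fin// mulr_ge0 ?half_line_pow_ge0 ?sqr_ge0.
- by rewrite lee_fin powR_ge0.
apply: eq_integral => u _; rewrite -!EFinM; congr EFin.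
rewrite add0r half_line_powM//.
have -> : sin (`|y| * u) ^+ 2 = sin (u * y) ^+ 2.
  rewrite mulrC; have [y1|y1] := leP 0 y; first by rewrite ger0_norm.
  by rewrite ltr0_norm// mulrN sinN sqrrN.
have e : `|y| `^ g * (`|y| * `|y| `^ (- g - 1)) = 1.
  rewrite -{2}(powRr1 (ltW ny)) -!(@powRD _ `|y|) ?(gt_eqF ny) ?implybT//.
  by rewrite (_ : g + (1 + (- g - 1)) = 0) ?powRr0//; ring.
by rewrite -[RHS]mul1r -[X in _ = X * _]e; ring.
Qed.

(** Integrate the preceding identity at y = Y, exchange the integrals by Tonelli, and use sin^2 x =
    (1 - cos(2x)) / 2. Working in the extended reals, the moment need not be known finite
    beforehand. *)
Lemma absolute_moment_charfun d (T : measurableType d) (P : probability T R)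
    (Y : T -> R) (phi : R -> R) g : measurable_fun setT Y -> 0 < g ->
  (forall theta, (\int[P]_w (cos (theta * Y w))%:E = (phi theta)%:E)%E) ->
  ((\int[P]_w (`|Y w| `^ g)%:E) * sine_integral g =
   \int[mu]_u (half_line_pow g u * ((1 - phi (2 * u)) / 2))%:E)%E.
Proof.
move=> mY g0 Yphi.
pose F (wu : T * R) := (half_line_pow g wu.2 * sin (wu.2 * Y wu.1) ^+ 2)%:E.
have F0 wu : (0 <= F wu)%E.
  by rewrite lee_fin mulr_ge0 ?half_line_pow_ge0 ?sqr_ge0.
have mF : measurable_fun [set: T * R] F.
  apply/measurable_EFinP; apply: measurable_funM.
    by apply: measurableT_comp => //; exact: measurable_half_line_pow.
  apply: measurable_funX; apply: measurableT_comp; first exact: measurable_sin.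
  by apply: measurable_funM => //; exact: measurableT_comp.
have sine0 : (0 <= sine_integral g)%E.
  by apply: integral_ge0 => u _; rewrite lee_fin mulr_ge0 ?half_line_pow_ge0 ?sqr_ge0.
have mYg : measurable_fun [set: T] (fun w => (`|Y w| `^ g)%:E).
  apply/measurable_EFinP; apply: measurable_fun_powR => //.
  exact: measurableT_comp.
rewrite -(ge0_integralZr P measurableT mYg)//.
under eq_integral do rewrite normr_powR_sine_integral//.
transitivity (\int[P]_w \int[mu]_u F (w, u))%E; first by [].
rewrite (fubini_tonelli (m1 := P) (m2 := mu) F mF F0); apply: eq_integral => u _.
rewrite /F/=.
have icos : P.-integrable setT (EFin \o (fun w => cos (2 * u * Y w))).
  apply: (@integrable_bounded _ _ _ _ _ 1).
    apply: measurableT_comp; first exact: measurable_cos.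
    exact: measurable_funM.
  by move=> w; rewrite ler_norml cos_geN1 cos_le1.
have i1 : P.-integrable setT (EFin \o (fun w : T => 1 : R)).
  exact: finite_measure_integrable_cst.
transitivity (\int[P]_w ((half_line_pow g u / 2)%:E *
    ((EFin \o (fun w : T => 1%R : R)) w - (EFin \o (fun w => cos (2 * u * Y w)%R)) w)))%E.
  apply: eq_integral => w _ /=; rewrite -EFinB -EFinM; congr EFin.
  have -> : 2 * u * Y w = (u * Y w) *+ 2 by rewrite mulr2n; ring.
  by rewrite cos_mulr2n cos2sin2 mulr2n; field.
rewrite integralZl//; last exact: integrableB.
rewrite integralB// Yphi.
have -> : (\int[P]_w (EFin \o (fun w : T => 1%R : R)) w = 1)%E.
  by rewrite /= integral_cst// mul1e; exact: probability_setT.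
by rewrite -EFinB -EFinM; congr EFin; field.
Qed.

End sine_moment.

(** * Bounds on 1 - exp(-J) and the integral of a stable exponent *)

Section stable_exponent.
Context {R : realType}.
Notation mu := (@lebesgue_measure R).
Implicit Types g q J K M u s : R.

Lemma onem_expRN_ge0 J : 0 <= J -> 0 <= 1 - expR (- J).
Proof. by move=> J0; rewrite subr_ge0 -expR0 ler_expR oppr_le0. Qed.

(** Uses 1 - exp(-J) <= J on ]0, 1] and 1 - exp(-J) <= 1 beyond; M + 1 dominates both constants. *)
Lemma half_line_pow_onem_expRN_le g q M J u : 0 <= M -> 0 <= J ->
  (0 < u -> u <= 1 -> J <= M * u `^ q) ->
  half_line_pow g u * (1 - expR (- J)) <=
  (M + 1) * piecewise_pow (q - g - 1) (- g - 1) u.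
Proof.
move=> M0 J0 JM; have M1 : 0 <= M + 1 by rewrite addr_ge0.
rewrite /half_line_pow; case: ifPn => u0; last first.
  by rewrite mul0r mulr_ge0 ?piecewise_pow_ge0.
have [u1|u1] := leP u 1.
  rewrite piecewise_pow_le1//.
  have -> : q - g - 1 = - g - 1 + q by ring.
  rewrite (@powRD _ u (- g - 1) q) ?(gt_eqF u0) ?implybT// mulrCA.
  rewrite ler_wpM2l ?powR_ge0//.
  apply: (@le_trans _ _ J); first by rewrite lerBlDl -lerBlDr expR_ge1Dx.
  apply: (le_trans (JM u0 u1)).
  by rewrite ler_wpM2r ?powR_ge0// lerDl.
rewrite piecewise_pow_gt1// mulrC; apply: ler_pM; rewrite ?powR_ge0 ?onem_expRN_ge0//.
by apply: (@le_trans _ _ 1); [rewrite gerBl expR_ge0|rewrite lerDr].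
Qed.

Lemma integral_expRN_oc c : 0 <= c ->
  (\int[mu]_(s in `]0%R, c]) (expR (- s))%:E = (1 - expR (- c))%:E)%E.
Proof.
rewrite le_eqVlt => /predU1P[<-|c0].
  by rewrite set_itvoc0 integral_set0 oppr0 expR0 subrr.
have dF (x : R) : is_derive x 1 (fun s : R => - expR (- s)) (expR (- x)).
  have h := is_derive1_comp (is_derive_expR (- x)) (is_deriveN (is_derive_id x 1)).
  by have := is_deriveN h; rewrite /GRing.scale/= mulrN1 opprK.
have cF : continuous (fun s : R => - expR (- s)).
  by move=> x; apply/differentiable_continuous/derivable1_diffP; have [] := dF x.
have cf : continuous (fun s : R => expR (- s)).
  by move=> x; apply: continuous_comp; [exact: continuousN|exact: continuous_expR].
rewrite integral_itv_obnd_cbnd; last first.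
  apply/measurable_EFinP; apply: (measurable_funS measurableT) => //.
  exact: continuous_measurable_fun.
rewrite (@continuous_FTC2 _ _ (fun s : R => - expR (- s)))//.
- by rewrite oppr0 expR0 -EFinB opprK addrC.
- exact: continuous_subspaceT.
- split.
  + by move=> x _; have [] := dF x.
  + by apply: cvg_at_right_filter; exact: cF.
  + by apply: cvg_at_left_filter; exact: cF.
- by move=> x _; rewrite derive1E; have [_ ->] := dF x.
Qed.

(* [1 - expR (- w)] is the integral of [expR (- s)] over `]0, w]; exchanging the
   integrals in [u] and [s] makes the gamma function appear. *)
Let stable_integrand g al K (us : R * R) : R :=
  if (0 < us.2) && (us.2 <= K * us.1 `^ al)
  then half_line_pow g us.1 * expR (- us.2) else 0.

Let measurable_stable_integrand g al K :
  measurable_fun [set: R * R] (fun us => (stable_integrand g al K us)%:E).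
Proof.
apply/measurable_EFinP; apply: measurable_fun_ifT => //=.
- apply: measurable_and; first exact: measurable_fun_ltr.
  apply: measurable_fun_ler => //; apply: measurable_funM => //.
  exact: measurable_fun_powR.
- apply: measurable_funM.
    by apply: measurableT_comp => //; exact: measurable_half_line_pow.
  apply: measurableT_comp; first exact: measurable_expR.
  exact: measurableT_comp.
Qed.

Let stable_integrand_ge0 g al K us : (0 <= (stable_integrand g al K us)%:E)%E.
Proof.
rewrite lee_fin /stable_integrand; case: ifP => // _.
by rewrite mulr_ge0 ?half_line_pow_ge0 ?expR_ge0.
Qed.

Let integral_stable_integrand1 g al K u : 0 <= K ->
  (\int[mu]_s (stable_integrand g al K (u, s))%:E =
   (half_line_pow g u * (1 - expR (- (K * u `^ al))))%:E)%E.
Proof.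
move=> K0; set c := K * u `^ al; have c0 : 0 <= c by rewrite mulr_ge0 ?powR_ge0.
have mexp : measurable_fun `]0%R, c] (fun s => (expR (- s))%:E).
  apply/measurable_EFinP; apply: measurableT_comp; first exact: measurable_expR.
  exact: measurable_funN.
rewrite EFinM -(integral_expRN_oc c0) -(ge0_integralZl mu _ mexp)//; last first.
  by rewrite lee_fin half_line_pow_ge0.
rewrite [RHS]integral_mkcond; apply: eq_integral => s _.
rewrite patchE /stable_integrand/= -/c; case: ifPn => [h|h].
  by rewrite mem_set ?EFinM//= in_itv/= h.
by rewrite memNset//= in_itv/= (negbTE h).
Qed.

(** For fixed s > 0 the constraint s <= K u^al reads u >= c with c = (s/K)^(1/al), and the tail
    integral of u^(-g-1) from c is c^(-g) / g. *)
Let integral_stable_integrand2 g al K s : 0 < g < al -> 0 < K ->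
  (\int[mu]_u (stable_integrand g al K (u, s))%:E =
   ((K `^ (g / al) / g)%:E * ((fun s => (s `^ (1 - g / al - 1) * expR (- s))%:E) \_ `]0%R, +oo[) s))%E.
Proof.
move=> /andP[g0 gal] K0; have al0 : 0 < al by exact: lt_trans gal.
rewrite patchE; case: ifPn => [|h]; last first.
  rewrite mule0 integral0_eq// => u _; rewrite /stable_integrand/=.
  by move: h; rewrite notin_setE/= in_itv/= andbT; case: ifPn => // /andP[].
rewrite inE/= in_itv/= andbT => s0.
pose c := (s / K) `^ al^-1.
have sK0 : 0 < s / K by rewrite divr_gt0.
have c0 : 0 < c by exact: powR_gt0.
have sc u : 0 < u -> (s <= K * u `^ al) = (c <= u).
  move=> u0; rewrite mulrC -ler_pdivrMr//.
  apply/idP/idP => h.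
    have -> : u = (u `^ al) `^ al^-1 by rewrite -powRrM mulfV ?gt_eqF// powRr1// ltW.
    by apply: ge0_ler_powR; rewrite ?nnegrE ?powR_ge0 ?invr_ge0 ?(ltW al0) ?(ltW sK0).
  have -> : s / K = c `^ al by rewrite -powRrM mulVf ?gt_eqF// powRr1// ltW.
  by apply: ge0_ler_powR; rewrite ?nnegrE ?(ltW al0) ?(ltW c0) ?(ltW u0).
transitivity (\int[mu]_u ((expR (- s))%:E * ((fun u => (u `^ (- g - 1))%:E) \_ `[c, +oo[) u))%E.
  apply: eq_integral => u _; rewrite patchE /stable_integrand/= s0/= /half_line_pow.
  have [u0|u0] := ltP 0 u; last first.
    rewrite mul0r if_same memNset ?mule0//= in_itv/= andbT; apply/negP.
    by rewrite -ltNge (le_lt_trans u0).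
  rewrite sc//; case: ifPn => cu.
    rewrite mem_set; last by rewrite /= in_itv/= cu.
    by rewrite -EFinM; congr EFin; rewrite mulrC.
  by rewrite memNset ?mule0//= in_itv/= (negbTE cu).
rewrite ge0_integralZl ?lee_fin ?expR_ge0//; last 2 first.
- by apply/(measurable_restrictT _ _).1 => //; exact: measurable_powR_EFin.
- by move=> u _; apply: erestrict_ge0 => v _; rewrite lee_fin powR_ge0.
rewrite -integral_mkcond integral_powR_cy//; last lra.
rewrite -!EFinM; congr EFin.
have -> : - g - 1 + 1 = - g by ring.
have -> : 1 - g / al - 1 = - (g / al) by ring.
have -> : c `^ (- g) = K `^ (g / al) * s `^ (- (g / al)).
  rewrite /c -powRrM powRM ?invr_ge0 ?(ltW s0) ?(ltW K0)// mulrC.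
  have e : al^-1 * - g = - (g / al) by field; rewrite gt_eqF.
  by rewrite e -(powR_inv1 (ltW K0)) -powRrM mulN1r opprK.
by rewrite opprK; field; rewrite gt_eqF.
Qed.

Lemma integral_half_line_pow_expR g al K : 0 < g < al -> 0 <= K ->
  (\int[mu]_u (half_line_pow g u * (1 - expR (- (K * u `^ al))))%:E =
   (K `^ (g / al) * Gamma (1 - g / al) / g)%:E)%E.
Proof.
move=> ga; have /andP[g0 gal] := ga; have al0 : 0 < al by exact: lt_trans gal.
rewrite le_eqVlt => /predU1P[<-|K0].
  rewrite powR0 ?gt_eqF ?divr_gt0// !mul0r integral0_eq// => u _.
  by rewrite mul0r oppr0 expR0 subrr mulr0.
(* Finiteness is obtained on this side, by the piecewise power majorant, and carried over to the
   gamma integral below. *)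
have Ioo : (\int[mu]_u (half_line_pow g u * (1 - expR (- (K * u `^ al))))%:E < +oo)%E.
  have p1 : -1 < al - g - 1 by lra.
  have q1 : - g - 1 < -1 by lra.
  have K1 : 0 <= K + 1 by lra.
  apply: (@le_lt_trans _ _ (\int[mu]_u ((K + 1)%:E *
      (piecewise_pow (al - g - 1) (- g - 1) u)%:E))%E).
    apply: ge0_le_integral => //.
    - move=> u _; rewrite lee_fin mulr_ge0 ?half_line_pow_ge0//.
      by rewrite onem_expRN_ge0// mulr_ge0 ?powR_ge0 ?ltW.
    - apply/measurable_EFinP; apply: measurable_funM.
        exact: measurable_half_line_pow.
      apply: measurable_funB => //; apply: measurableT_comp; first exact: measurable_expR.
      by apply: measurableT_comp => //; apply: measurable_funM.
    - apply: measurable_funeM; apply/measurable_EFinP.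
      exact: measurable_piecewise_pow.
    - move=> u _; rewrite -EFinM lee_fin half_line_pow_onem_expRN_le ?(ltW K0)//.
      by rewrite mulr_ge0 ?powR_ge0 ?ltW.
  rewrite ge0_integralZl//.
  - by rewrite lte_mul_pinfty ?lee_fin// integral_piecewise_pow_lty.
  - by apply/measurable_EFinP; exact: measurable_piecewise_pow.
  - by move=> u _; rewrite lee_fin piecewise_pow_ge0.
pose G := (\int[mu]_(s in `]0%R, +oo[) (s `^ (1 - g / al - 1) * expR (- s))%:E)%E.
have IG : (\int[mu]_u (half_line_pow g u * (1 - expR (- (K * u `^ al))))%:E =
    (K `^ (g / al) / g)%:E * G)%E.
  transitivity (\int[mu]_u \int[mu]_s (stable_integrand g al K (u, s))%:E)%E.
    by apply: eq_integral => u _; rewrite integral_stable_integrand1// ltW.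
  rewrite (fubini_tonelli (m1 := mu) (m2 := mu) _
    (measurable_stable_integrand g al K) (stable_integrand_ge0 g al K)).
  under eq_integral do rewrite integral_stable_integrand2//.
  rewrite ge0_integralZl//.
  - by rewrite -integral_mkcond.
  - apply/(measurable_restrictT _ _).1 => //; apply/measurable_EFinP.
    apply: (measurable_funS measurableT) => //.
    apply: measurable_funM; first exact: measurable_fun_powR.
    by apply: measurableT_comp; [exact: measurable_expR|].
  - move=> s _; apply: erestrict_ge0 => v _.
    by rewrite lee_fin mulr_ge0 ?powR_ge0 ?expR_ge0.
  - by rewrite lee_fin divr_ge0 ?powR_ge0 ?ltW.
have C0 : 0 < K `^ (g / al) / g by rewrite divr_gt0// powR_gt0.
have G0 : (0 <= G)%E.
  by apply: integral_ge0 => s _; rewrite lee_fin mulr_ge0 ?powR_ge0 ?expR_ge0.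
(* [Gamma] is a real-valued integral, with default 0 in case of divergence; finiteness of [G]
   follows from [Ioo] because its coefficient is positive. *)
have Gfin : G \is a fin_num.
  rewrite ge0_fin_numE// ltey; apply/eqP => Gy.
  by move: Ioo; rewrite IG Gy gt0_muley ?lte_fin// ltxx.
rewrite IG /Gamma /Rintegral -/G -(fineK Gfin) -EFinM /=; congr EFin.
by rewrite mulrAC.
Qed.

End stable_exponent.

(** * The limit *)

Section limit.
Context {R : realType}.
Notation mu := (@lebesgue_measure R).
Implicit Types (H l a g theta : R) (A : R -> R).

Lemma measurable_incr_energy H l a A : 0 < a -> (forall y, a <= A y <= 2) ->
  measurable_fun [set: R] A ->
  measurable_fun [set: R] (fun theta => incr_energy H l A theta).
Proof.
move=> a0 aA mA.
pose f (z : R * R) := (`|z.1 * tempered_incr l (H - (A z.2)^-1) z.2| `^ A z.2)%:E.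
have mf : measurable_fun [set: R * R] f.
  apply/measurable_EFinP; apply: measurable_fun_powR; last exact: measurableT_comp.
  apply: measurableT_comp => //; apply: measurable_funM => //.
  apply: measurable_tempered_incr => //; apply: measurable_funB => //.
  apply: measurable_fun_invr => [z|]; last exact: measurableT_comp.
  by have /andP[aAy _] := aA z.2; exact: le_trans (ltW a0) aAy.
have f0 z : (0 <= f z)%E by rewrite lee_fin powR_ge0.
exact: (measurable_fun_fubini_tonelli_F (m2 := mu) f mf f0).
Qed.

(** A constant index makes the energy homogeneous of degree [A0] in theta: the limit law is
    stable. *)
Lemma incr_energy_cst H (A0 : R) theta : 0 < A0 <= 2 ->
  incr_energy H 0 (cst A0) theta =
  ((`|theta| `^ A0)%:E * incr_energy H 0 (cst A0) 1)%E.
Proof.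
move=> /andP[A00 A02].
have mf := @measurable_incr_integrand R H 0 A0 (cst A0) 1 (measurable_cst A0) A00.
rewrite /incr_energy -(ge0_integralZl mu measurableT (mf _)).
- apply: eq_integral => y _; rewrite -EFinM mul1r normrM powRM//.
- by move=> y; rewrite lexx.
- by move=> y _; rewrite lee_fin powR_ge0.
- by rewrite lee_fin powR_ge0.
Qed.

Lemma onem_charfun_ge0 H l A g u :
  0 <= half_line_pow g u * ((1 - expR (- fine (incr_energy H l A (2 * u)))) / 2).
Proof.
rewrite mulr_ge0 ?half_line_pow_ge0// divr_ge0 ?onem_expRN_ge0//.
by rewrite fine_ge0// incr_energy_ge0.
Qed.

(** The 8 arises from evaluating at 2u: for 0 < u <= 1 and a <= 2, both (2u)^a and (2u)^2 are at
    most 4 u^a. *)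
Definition charfun_majorant H a g u : R :=
  (8 * fine (\int[mu]_y (incr_majorant H a y)%:E)%E + 1) *
  piecewise_pow (a - g - 1) (- g - 1) u.

Lemma onem_charfun_le H l a A g u : 0 < a <= 2 -> (forall y, a <= A y <= 2) ->
  measurable_fun [set: R] A -> 0 < H < 1 -> 0 <= l ->
  half_line_pow g u * ((1 - expR (- fine (incr_energy H l A (2 * u)))) / 2) <=
  charfun_majorant H a g u.
Proof.
move=> /andP[a0 a2] aA mA H01 l0; rewrite /charfun_majorant.
pose D := fine (\int[mu]_y (incr_majorant H a y)%:E)%E.
have DE : (\int[mu]_y (incr_majorant H a y)%:E = D%:E)%E.
  apply/esym/fineK.
  exact: (integrable_fin_num measurableT (integrable_incr_majorant a0 H01)).
have D0 : 0 <= D.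
  by rewrite fine_ge0//; apply: integral_ge0 => y _; rewrite lee_fin incr_majorant_ge0.
have finJ : incr_energy H l A (2 * u) \is a fin_num.
  by rewrite ge0_fin_numE ?incr_energy_ge0//; exact: (incr_energy_lty _ a0).
have := @incr_energy_le R H l a A (2 * u) a0 aA mA H01 l0.
rewrite DE -(fineK finJ) -EFinM lee_fin fineK//.
have J0 : 0 <= fine (incr_energy H l A (2 * u)).
  by rewrite fine_ge0// incr_energy_ge0.
move: (fine (incr_energy _ _ _ _)) J0 => J J0 JD; rewrite -/D.
apply: (@le_trans _ _ (half_line_pow g u * (1 - expR (- J)))).
  have := onem_expRN_ge0 J0; move: (1 - _) => e e0.
  by rewrite ler_wpM2l ?half_line_pow_ge0//; lra.
apply: half_line_pow_onem_expRN_le => //; first by rewrite mulr_ge0.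
move=> u0 u1; apply: (le_trans JD).
rewrite mulrAC ler_wpM2r// ger0_norm ?mulr_ge0 ?(ltW u0)//.
rewrite !powRM ?(ltW u0)//.
have e4 : 2 `^ 2 = 4 :> R by rewrite (powR_mulrn 2)//; ring.
have e2 : 2 `^ a <= 4 :> R by rewrite -e4; apply: ler_powR => //; rewrite ler1n.
have e3 : u `^ 2 <= u `^ a by apply: ger_powR => //; rewrite u0.
rewrite e4; have -> : 8 * u `^ a = 4 * u `^ a + 4 * u `^ a by ring.
by rewrite lerD// ?ler_wpM2r ?ler_wpM2l ?powR_ge0.
Qed.

Lemma integrable_charfun_majorant H a g : 0 < g < a ->
  mu.-integrable [set: R] (EFin \o charfun_majorant H a g).
Proof.
move=> /andP[g0 ga].
have p1 : -1 < a - g - 1 by lra.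
have q1 : - g - 1 < -1 by lra.
have ip : mu.-integrable [set: R] (EFin \o piecewise_pow (a - g - 1) (- g - 1)).
  apply/integrableP; split.
    by apply/measurable_EFinP; exact: measurable_piecewise_pow.
  under eq_integral do rewrite gee0_abs ?lee_fin ?piecewise_pow_ge0//.
  exact: integral_piecewise_pow_lty.
apply: eq_integrable (integrableZl measurableT
  (8 * fine (\int[mu]_y (incr_majorant H a y)%:E)%E + 1) ip) => // u _.
Qed.

Lemma measurable_onem_charfun H l a A g : 0 < a -> (forall y, a <= A y <= 2) ->
  measurable_fun [set: R] A -> measurable_fun [set: R] (fun u =>
    (half_line_pow g u * ((1 - expR (- fine (incr_energy H l A (2 * u)))) / 2))%:E).
Proof.
move=> a0 aA mA; apply/measurable_EFinP; apply: measurable_funM.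
  exact: measurable_half_line_pow.
apply: measurable_funM => //; apply: measurable_funB => //.
apply: measurableT_comp; first exact: measurable_expR.
apply: measurableT_comp => //.
apply: (measurableT_comp (fine_measurable measurableT)).
apply: (measurableT_comp (measurable_incr_energy H l a0 aA mA)).
exact: measurable_funM.
Qed.

Lemma integral_onem_charfun_fin_num H l a A g : 0 < g < a -> a <= 2 ->
  (forall y, a <= A y <= 2) -> measurable_fun [set: R] A ->
  0 < H < 1 -> 0 <= l ->
  (\int[mu]_u (half_line_pow g u *
    ((1 - expR (- fine (incr_energy H l A (2 * u)%R))) / 2))%:E)%E \is a fin_num.
Proof.
move=> ga a2 aA mA H01 l0; have a0 : 0 < a.
  by have /andP[g0] := ga; exact: lt_trans.
apply: (integrable_fin_num measurableT).
apply: (le_integrable measurableT _ _ (integrable_charfun_majorant H ga)).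
  exact: (measurable_onem_charfun H l g a0 aA mA).
move=> u _ /=; rewrite lee_fin ger0_norm ?onem_charfun_ge0//.
by apply: le_trans (ler_norm _); apply: onem_charfun_le => //; rewrite a0.
Qed.

(** Second dominated convergence, now in [u]: the integrands converge by [cvg_incr_energy] to a
    stable exponent, whose integral is evaluated by the gamma function since g < a <= A0. *)
Lemma cvg_integral_onem_charfun H g a (l : R^nat) (A : nat -> R -> R) (A0 K : R) :
  0 < g < a -> (forall n y, a <= A n y <= 2) -> a <= A0 <= 2 ->
  (forall n, measurable_fun [set: R] (A n)) -> 0 < H < 1 ->
  (forall n, 0 <= l n) -> l n @[n --> \oo] --> 0 ->
  (forall y, A n y @[n --> \oo] --> A0) ->
  incr_energy H 0 (cst A0) 1 = K%:E ->
  (\int[mu]_u (half_line_pow g u *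
     ((1 - expR (- fine (incr_energy H (l n) (A n) (2 * u)%R))) / 2))%:E)%E
    @[n --> \oo] -->
  (2 `^ (g - 1) * (K `^ (g / A0) *
     Gamma (1 - g / A0) / g))%:E.
Proof.
move=> /andP[g0 ga] aA aA0 mA H01 l0 ll0 AA0 KE.
have a0 : 0 < a by exact: lt_trans ga.
have /andP[aA0' A02] := aA0.
have A00 : 0 < A0 by exact: lt_le_trans aA0'.
have a2 : a <= 2 by exact: le_trans A02.
have K0 : 0 <= K by rewrite -lee_fin -KE incr_energy_ge0.
pose f_ n u := (half_line_pow g u *
  ((1 - expR (- fine (incr_energy H (l n) (A n) (2 * u)%R))) / 2))%:E.
pose f u := (half_line_pow g u * ((1 - expR (- (`|2 * u| `^ A0 * K))) / 2))%:E.
pose G u := (charfun_majorant H a g u)%:E.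
have mf_ n : measurable_fun [set: R] (f_ n).
  exact: (measurable_onem_charfun H (l n) g a0 (aA n) (mA n)).
have f_f u : [set: R] u -> f_ n u @[n --> \oo] --> f u.
  move=> _; apply: cvg_EFin; first exact: nearW.
  apply: cvgM; first exact: cvg_cst.
  apply: cvgM; last exact: cvg_cst.
  apply: cvgB; first exact: cvg_cst.
  apply: continuous_cvg; first exact: continuous_expR.
  apply: cvgN; apply: fine_cvg.
  rewrite EFinM -KE -incr_energy_cst ?A00//.
  exact: (@cvg_incr_energy R H l A a A0 (2 * u) a0 aA aA0 mA H01 l0 ll0 AA0).
have finG u : [set: R] u -> G u \is a fin_num by [].
have iG : mu.-integrable [set: R] G by apply: integrable_charfun_majorant; rewrite g0.
have f_G n u : [set: R] u -> (`|f_ n u| <= G u)%E.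
  move=> _; rewrite gee0_abs ?lee_fin ?onem_charfun_ge0//.
  by apply: onem_charfun_le => //; rewrite a0.
have := dominated_cvg (mu := mu) measurableT mf_ f_f finG iG f_G.
suff -> : (\int[mu]_u f u = (2 `^ (g - 1) * (K `^ (g / A0) *
     Gamma (1 - g / A0) / g))%:E)%E by [].
(* The argument 2u puts 2^A0 into the constant; its power g / A0 is 2^g, and the factor 1/2 turns
   this into 2^(g-1). *)
pose K2 := 2 `^ A0 * K.
have K20 : 0 <= K2 by rewrite mulr_ge0 ?powR_ge0.
transitivity (\int[mu]_u ((2^-1)%:E *
    (half_line_pow g u * (1 - expR (- (K2 * u `^ A0)))) %:E))%E.
  apply: eq_integral => u _; rewrite /f -EFinM; congr EFin.
  rewrite /half_line_pow; case: ifPn => u0; last by rewrite !mul0r mulr0.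
  rewrite ger0_norm ?mulr_ge0 ?(ltW u0)// powRM ?(ltW u0)// /K2.
  have -> : 2 `^ A0 * u `^ A0 * K = 2 `^ A0 * K * u `^ A0 by ring.
  by ring.
have mK : measurable_fun [set: R]
    (fun u => (half_line_pow g u * (1 - expR (- (K2 * u `^ A0))))%:E).
  apply/measurable_EFinP; apply: measurable_funM; first exact: measurable_half_line_pow.
  apply: measurable_funB => //; apply: measurableT_comp; first exact: measurable_expR.
  by apply: measurableT_comp => //; apply: measurable_funM.
rewrite (ge0_integralZl mu measurableT mK); last 2 first.
- by move=> u _; rewrite lee_fin mulr_ge0 ?half_line_pow_ge0 ?onem_expRN_ge0// mulr_ge0 ?powR_ge0.
- by rewrite lee_fin invr_ge0.
rewrite integral_half_line_pow_expR ?g0 ?(lt_le_trans ga)// -EFinM; congr EFin.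
rewrite /K2 powRM ?powR_ge0// -powRrM.
have -> : A0 * (g / A0) = g by field; rewrite gt_eqF.
rewrite (@powRD _ 2 g (-1)) ?powR_inv1//; last by rewrite (@gt_eqF _ _ 2) ?implybT.
by ring.
Qed.

End limit.

(** * The moment of the rescaled increment as an integral *)

Section scaled_moment.
Context {R : realType} {d : measure_display} {T : measurableType d}.
Variable P : probability T R.
Notation mu := (@lebesgue_measure R).

(** Applied to Y = r^(-H) (X(t+r) - X(t)): the factor r^(-H) cancels the r^H inside the energy, so
    [r] survives only in the rate and in the index. *)
Lemma LTFmSM_scaled_moment (H a lambda g : R) (alpha : R -> R)
    (X : R -> {RV P >-> R}) (t r : R) :
  0 < a -> (forall x, a <= alpha x <= 2) -> continuous alpha ->
  0 < H < 1 -> 0 <= lambda -> LTFmSM H alpha lambda X -> 0 < g -> 0 < r ->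
  ('E_P[fun w => (`|X (t + r) w - X t w| `^ g)%R] / (r `^ (g * H))%:E
     * sine_integral g =
   \int[mu]_u (half_line_pow g u * ((1 - expR (- fine
     (incr_energy H (lambda * r) (fun y => alpha (t + r * y)) (2 * u))))
       / 2))%:E)%E.
Proof.
move=> a0 halpha calpha H01 lambda0 XL g0 r0.
pose Y w := r `^ (- H) * (X (t + r) w - X t w).
have rH0 : 0 < r `^ H by exact: powR_gt0.
have mD : measurable_fun setT (fun w => X (t + r) w - X t w).
  exact: measurable_funB.
have mY : measurable_fun setT Y by exact: measurable_funM.
pose phi theta := expR (- fine
  (incr_energy H (lambda * r) (fun y => alpha (t + r * y)) theta)).
have Yphi theta : (\int[P]_w (cos (theta * Y w))%:E = (phi theta)%:E)%E.
  transitivity (\int[P]_w (cos (theta * r `^ (- H) * (X (t + r) w - X t w)))%:E)%E.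
    by apply: eq_integral => w _; rewrite /Y mulrA.
  rewrite (LTFmSM_charfun t _ a0 halpha calpha H01 lambda0 XL r0).
  have -> : r `^ H * (theta * r `^ (- H)) = theta; last by [].
  by rewrite mulrCA powRN mulfV ?mulr1// gt_eqF.
rewrite -[RHS](absolute_moment_charfun mY g0 Yphi).
congr (_ * _)%E; rewrite expectation.unlock inver gt_eqF ?powR_gt0//.
have mDg : measurable_fun setT (fun w => (`|X (t + r) w - X t w| `^ g)%:E).
  apply/measurable_EFinP; apply: measurable_fun_powR => //.
  exact: measurableT_comp.
have D0 w : [set: T] w -> (0 <= (`|X (t + r) w - X t w| `^ g)%:E)%E.
  by move=> _; rewrite lee_fin powR_ge0.
have r1 : (0 <= ((r `^ (g * H))^-1)%:E)%E by rewrite lee_fin invr_ge0 powR_ge0.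
rewrite -(ge0_integralZr P measurableT mDg D0 r1).
apply: eq_integral => w _; rewrite -EFinM; congr EFin.
rewrite /Y normrM (ger0_norm (powR_ge0 _ _)) powRM ?powR_ge0//.
by rewrite -powRrM mulNr powRN (mulrC H) [LHS]mulrC.
Qed.

End scaled_moment.

(** * Assembly of the limit formula *)

Theorem proposition10 (R : realType) (d : measure_display)
    (T : measurableType d) (P : probability T R)
    (a b H lambda : R) (alpha : R -> R) (X : R -> {RV P >-> R})
    (ha : 0 < a) (hab : a <= b) (hb : b <= 2)
    (halpha : forall x, a <= alpha x <= b) (calpha : continuous alpha)
    (hH : 0 < H < 1) (hlambda : 0 < lambda)
    (hX : LTFmSM H alpha lambda X)
    (t : R) (ht : H * alpha t <> 1) (gamma : R) (hgamma : 0 < gamma < a) :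
  ('E_P[fun w => (`|X (t + r) w - X t w| `^ gamma)%R]
     / (r `^ (gamma * H))%:E)%E @[r --> 0^'+]
    --> (Flim H alpha gamma t)%:E.
Proof.
have /andP[gamma0 gammaa] := hgamma.
have halpha2 x : a <= alpha x <= 2.
  by have /andP[-> /le_trans ->] := halpha x.
have /andP[aA0 A02] := halpha2 t.
have A00 : 0 < alpha t by exact: lt_le_trans aA0.
have malpha : measurable_fun [set: R] alpha by exact: continuous_measurable_fun.
have a2 : a <= 2 by exact: le_trans A02.
set K := (\int[lebesgue_measure]_x
  (`|pow0 (pospart (1 - x)) (H - (alpha t)^-1)
     - pow0 (pospart (- x)) (H - (alpha t)^-1)| `^ alpha t))%R.
(* At rate 0 the exponential factors equal 1. Finiteness of the energy ensures that the real-valued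
   integral [K] is its true value. *)
have KE : incr_energy H 0 (cst (alpha t)) 1 = K%:E.
  rewrite -[LHS]fineK; last first.
    rewrite ge0_fin_numE ?incr_energy_ge0//.
    by apply: (incr_energy_lty _ ha) => // y; rewrite aA0.
  congr EFin; congr fine; apply: eq_integral => y _.
  by rewrite mul1r /tempered_incr /tempered_pow oppr0 !mul0r expR0 !mul1r.
have S0 := sine_integral_gt0 gamma0.
have Soo : (sine_integral gamma < +oo)%E.
  by apply: sine_integral_lty; rewrite gamma0 (lt_le_trans gammaa).
have SE : (\int[lebesgue_measure]_(u in `]0%R, +oo[)
    (u `^ (- gamma - 1) * sin u ^+ 2))%R = fine (sine_integral gamma).
  by congr fine; exact: (integral_half_line (fun u => sin u ^+ 2)).
have [S SSE] : exists S, sine_integral gamma = S%:E.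
  by exists (fine (sine_integral gamma)); rewrite fineK// ge0_fin_numE// ltW.
rewrite /Flim -/K SE SSE /=; move: S0; rewrite SSE lte_fin => S0.
pose N r := (\int[lebesgue_measure]_u (half_line_pow gamma u * ((1 - expR (- fine
  (incr_energy H (lambda * r) (fun y => alpha (t + r * y)) (2 * u)))) / 2))%:E)%E.
pose L := 2 `^ (gamma - 1) * (K `^ (gamma / alpha t) *
  Gamma (1 - gamma / alpha t) / gamma).
(* Dominated convergence is available along sequences, so the limit r -> 0+ is tested on positive
   sequences tending to 0. *)
have cvgN (u : R^nat) : (forall n, 0 < u n) -> u n @[n --> \oo] --> 0 ->
    N (u n) @[n --> \oo] --> L%:E.
  move=> u0 uu0; apply: (cvg_integral_onem_charfun (a := a) _ _ _ _ _ _ _ _ KE) => //.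
  - move=> n; apply: measurableT_comp => //.
    by apply: measurable_funD => //; exact: measurable_funM.
  - by move=> n; rewrite mulr_ge0// ltW.
  - by rewrite -[X in _ --> X](mulr0 lambda); apply: cvgM => //; exact: cvg_cst.
  - move=> y; apply: continuous_cvg; first exact: calpha.
    rewrite -[X in _ --> X]addr0; apply: cvgD; first exact: cvg_cst.
    by rewrite -[X in _ --> X](mul0r y); apply: cvgM => //; exact: cvg_cst.
have momentE r : 0 < r ->
    ('E_P[fun w => (`|X (t + r) w - X t w| `^ gamma)%R] / (r `^ (gamma * H))%:E =
     N r * (S^-1)%:E)%E.
  move=> r0; rewrite /N.
  rewrite -(LTFmSM_scaled_moment t ha halpha2 calpha hH (ltW hlambda) hX gamma0 r0).
  by rewrite SSE -muleA -EFinM mulfV ?gt_eqF// mule1.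
have limE : K `^ (gamma / alpha t) *
    (2 `^ (gamma - 1) * Gamma (1 - gamma / alpha t) / (gamma * S)) = L * S^-1.
  by rewrite /L; field; rewrite !gt_eqF.
rewrite limE.
apply: (@cvg_trans _ ((N r * (S^-1)%:E)%E @[r --> 0^'+])).
  by apply: near_eq_cvg; near=> r; rewrite momentE.
(* Finiteness near 0 reduces the extended-real limit to a real one, where the sequential criterion
   for right limits applies. *)
have Nfin : \forall r \near 0^'+, N r \is a fin_num.
  near=> r; apply: (integral_onem_charfun_fin_num _ a2) => //.
  - apply: measurableT_comp => //.
    by apply: measurable_funD => //; exact: measurable_funM.
  - by rewrite mulr_ge0// ltW.
rewrite EFinM; apply: cvgeZr => //.
apply: cvg_EFin => //.
apply/cvg_at_rightP => u [u0 uu0].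
by apply: fine_cvg; exact: cvgN.
Unshelve. all: by end_near. Qed.
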